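(* Let $q\in[1,+\infty)$ and let $\Sigma^Q$ be a pseudo-rational system of order zero, given by a $d\times d$ matrix $Q$ and a $d\times m$ matrix $P$ with entries in $M(\mathbb{R}_-)$. Then $\Sigma^Q$ is $X^{Q,q}$ quasi-reachable (resp. $X^{Q,q}$ reachable) if and only if it is $X^{Q,q}$ quasi-reachable (resp. $X^{Q,q}$ reachable) in time $\widetilde T$ for all $\widetilde T>-l(\det(Q))$. In particular, if $\Sigma^Q$ is $X^{Q,q}$ quasi-reachable (resp. $X^{Q,q}$ reachable), an upper bound on the minimal time of quasi-reachability $T^{\rm qr}_{\min,q}$ (resp. of reachability $T^{\rm r}_{\min,q}$) is given by $-l(\det(Q))$.
   Context: Notation: $\mathbb{R}_-=(-\infty,0]$, $\mathbb{R}_+=[0,+\infty)$; $d,m$ are positive integers; $*$ denotes convolution (products and determinants of matrices of distributions are taken with respect to convolution); $\delta_t$ is the Dirac distribution at $t$; $I_d$ is the identity matrix. $M(\mathbb{R}_-)$ is the space of distributions of order zero (Radon measures) on $\mathbb{R}$ with compact support contained in $\mathbb{R}_-$. $M_+(\mathbb{R})$ is the space of distributions of order zero (Radon measures) on $\mathbb{R}$ with support bounded on the left. For a distribution (or function) $\alpha$ on $\mathbb{R}$, $l(\alpha):=\inf \mathrm{supp}(\alpha)$. Truncation: for a function $f$ on $\mathbb{R}$, $\pi(f):=f_{|\mathbb{R}_+}$. For a distribution $\alpha\in\mathcal{D}'(\mathbb{R})$, $\pi\alpha$ is the restriction of $\alpha$ to test functions in $\mathcal{D}(\mathbb{R}_+)$,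 the infinitely differentiable functions on $\mathbb{R}$ with compact support contained in $\mathbb{R}_+$. These operations are applied entrywise to vectors and matrices. Function spaces, for $q\in[1,+\infty)$: $\Omega_q:=\bigcup_{i\ge1}L^q([-i,0],\mathbb{R})$, whose elements are regarded as functions on $\mathbb{R}$ vanishing outside a compact subset of $\mathbb{R}_-$; $\Gamma_q:=L^q_{\rm loc}(\mathbb{R}_+,\mathbb{R})$, with the Fréchet topology given by the $L^q$ seminorms on compact intervals (and the product topology on $(\Gamma_q)^d$). Elements of $\Gamma_q$ are extended by zero to $\mathbb{R}$ when convolved. A pseudo-rational system of order zero $\Sigma^Q$ is given by a $d\times d$ matrix $Q$ and a $d\times m$ matrix $P$ with entries in $M(\mathbb{R}_-)$ such that $Q$ has a convolution inverse over $M_+(\mathbb{R})$, i.e. there is a $d\times d$ matrix $Q^{-1}$ with entries in $M_+(\mathbb{R})$ such that $Q^{-1}*Q=Q*Q^{-1}=\delta_0I_d$. Its impulse response matrix is $A:=Q^{-1}*P$ and its input-output relation is $y=\pi(A*u)$, with $u\in(\Omega_q)^m$ and $y\in(\Gamma_q)^d$. Its state space is $X^{Q,q}:=\{y\in(\Gamma_q)^d \mid \pi(Q*y)=0\}$. $\Sigma^Q$ is: - $X^{Q,q}$ quasi-reachable if for all $y\in X^{Q,q}$ there is a sequence $(u_n)_{n\in\mathbb{N}}$ in $(\Omega_q)^m$ with $\pi(Q^{-1}*P*u_n)\to y$ in $(L^q_{\rm loc}(\mathbb{R}_+,\mathbb{R}))^d$ as $n\to+\infty$; - $X^{Q,q}$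 quasi-reachable in time $T>0$ if the same holds with each $u_n$ supported in $[-T,0]$; - $X^{Q,q}$ reachable if for all $y\in X^{Q,q}$ there is $u\in(\Omega_q)^m$ with $\pi(Q^{-1}*P*u)=y$; - $X^{Q,q}$ reachable in time $T>0$ if the same holds with $u$ supported in $[-T,0]$. The minimal times $T^{\rm qr}_{\min,q}$ and $T^{\rm r}_{\min,q}$ are the infima of the $T>0$ such that $\Sigma^Q$ is $X^{Q,q}$ quasi-reachable in time $T$, respectively $X^{Q,q}$ reachable in time $T$. *)

(* Defs.v *)
From HB Require Import structures.
From mathcomp Require Import all_boot all_order all_algebra perm.
From mathcomp Require Import all_classical all_reals all_analysis.
Set Implicit Arguments.
Unset Strict Implicit.
Unset Printing Implicit Defensive.
Import Order.TTheory GRing.Theory Num.Theory.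
Import numFieldNormedType.Exports.
Local Open Scope classical_set_scope.
Local Open Scope ring_scope.

(* A distribution of order zero on the line is a real Radon measure, i.e. a
   locally finite signed Borel measure.  As it may have infinite positive and
   infinite negative mass, it is a real-valued function of the bounded Borel
   sets only: it is encoded by a total function [set R -> R] whose values
   elsewhere are irrelevant, and two of them are compared with [meas_eq]. *)
Section RadonMeasures.
Context {R : realType}.
Implicit Types (mu nu : set R -> R) (A : set R) (f : R -> R).

Definition bounded_borel A : Prop := measurable A /\ bounded_set A.

Definition radon mu : Prop :=
  forall K : set R, compact K ->
    exists nu : {charge set (measurableTypeR R) -> \bar R},
      forall A, measurable A -> A `<=` K -> nu A = (mu A)%:E.

Definition meas_eq mu nu : Prop := forall A, bounded_borel A -> mu A = nu A.

Definition supp mu : set R :=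
  [set x | forall U : set R, open U -> U x ->
     exists A, [/\ bounded_borel A, A `<=` U & mu A <> 0]].

(* Only meaningful when the support is nonempty and bounded below
   ([inf] takes the value 0 otherwise). *)
Definition inf_supp mu : R := inf (supp mu).

Definition M_minus mu : Prop :=
  [/\ radon mu, compact (supp mu) & supp mu `<=` `]-oo, 0]].

Definition M_plus mu : Prop :=
  radon mu /\ exists a : R, supp mu `<=` `[a, +oo[.

Definition delta0 : set R -> R := fun A => fine (dirac (0 : R) A).

(* Upper variation: the positive part of the Jordan decomposition. *)
Definition upvar mu (A : set (measurableTypeR R)) : \bar R :=
  ereal_sup [set (mu B)%:E | B in [set B | bounded_borel B /\ B `<=` A]].

Definition integral_against mu f : R :=
  fine (\int[upvar mu]_t (f t)%:E)
  - fine (\int[upvar (fun A => - mu A)%R]_t (f t)%:E).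

(* (mu * nu)(A) = \int nu(A - t) dmu(t) *)
Definition mconv mu nu : set R -> R :=
  fun A => integral_against mu (fun t => nu [set x - t | x in A]).

(* (mu * f)(x) = \int f(x - t) dmu(t); this is defined for almost every x when
   mu is in M_plus and f is locally integrable with support bounded on the
   left. *)
Definition convf mu f : R -> R :=
  fun x => integral_against mu (fun t => f (x - t)).

Definition mxconv (n p r : nat) (A : 'M[set R -> R]_(n, p))
    (B : 'M[set R -> R]_(p, r)) : 'M[set R -> R]_(n, r) :=
  \matrix_(i, j) (fun S => \sum_(k < p) mconv (A i k) (B k j) S).

Definition mxconvf (n p : nat) (A : 'M[set R -> R]_(n, p))
    (u : 'I_p -> R -> R) : 'I_n -> R -> R :=
  fun i x => \sum_(k < p) convf (A i k) (u k) x.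

Definition mxdelta (n : nat) : 'M[set R -> R]_n :=
  \matrix_(i, j) (fun S => if i == j then delta0 S else 0).

(* The Leibniz formula in the convolution algebra. *)
Definition convdet (n : nat) (A : 'M[set R -> R]_n) : set R -> R :=
  fun S => \sum_(s : 'S_n)
    (-1) ^+ s * (\big[mconv/delta0]_(i < n) A i (s i)) S.

Definition mx_meas_eq (n p : nat) (A B : 'M[set R -> R]_(n, p)) : Prop :=
  forall i j, meas_eq (A i j) (B i j).

Definition conv_inverse (n : nat) (Q Qinv : 'M[set R -> R]_n) : Prop :=
  [/\ forall i j, M_plus (Qinv i j),
      mx_meas_eq (mxconv Qinv Q) (mxdelta n) &
      mx_meas_eq (mxconv Q Qinv) (mxdelta n)].

End RadonMeasures.

(* Elements of the spaces L^q and L^q_loc are given by representatives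
   [R -> R] that vanish outside the domain (which extends them by zero to the
   line), and they are equal when they are equal almost everywhere. *)
Section FunctionSpaces.
Context {R : realType}.

Definition restr_pos (f : R -> R) : R -> R := f \_ `[0, +oo[.

Definition vanishes_outside (K : set R) (f : R -> R) : Prop :=
  forall x, ~ K x -> f x = 0.

Definition Omega (q : R) (f : R -> R) : Prop :=
  f \in Lfun (@lebesgue_measure R) q%:E /\
  exists2 i : nat, (0 < i)%N & vanishes_outside `[- i%:R, 0] f.

Definition Gamma (q : R) (f : R -> R) : Prop :=
  vanishes_outside `[0, +oo[ f /\
  forall b : R, (f \_ `[0, b]) \in Lfun (@lebesgue_measure R) q%:E.

Definition ae_equal (f g : R -> R) : Prop :=
  ae_eq (@lebesgue_measure R) setT f g.

Definition cvg_Lloc (q : R) (f : nat -> R -> R) (g : R -> R) : Prop :=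
  forall b : R,
    ('N[@lebesgue_measure R]_q%:E [EFin \o ((f n \- g)%R \_ `[0%R, b])])%E
      @[n --> \oo] --> 0%E.

End FunctionSpaces.

Section Systems.
Context {R : realType} (q : R) (d m : nat).
Implicit Types (Q Qinv : 'M[set R -> R]_d) (P : 'M[set R -> R]_(d, m)).
Implicit Types (u : 'I_m -> R -> R) (y : 'I_d -> R -> R).

Definition input u : Prop := forall k, Omega q (u k).

Definition input_in (T : R) u : Prop :=
  input u /\ forall k, vanishes_outside `[- T, 0] (u k).

Definition state_space Q : set ('I_d -> R -> R) :=
  [set y | (forall i, Gamma q (y i)) /\
           forall i, ae_equal (restr_pos (mxconvf Q y i)) (cst 0)].

Definition output Qinv P u : 'I_d -> R -> R :=
  fun i => restr_pos (mxconvf (mxconv Qinv P) u i).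

Definition quasi_reachable Q Qinv P : Prop :=
  forall y, state_space Q y ->
    exists u_ : nat -> 'I_m -> R -> R,
      (forall n, input (u_ n)) /\
      forall i, cvg_Lloc q (fun n => output Qinv P (u_ n) i) (y i).

Definition quasi_reachable_in Q Qinv P (T : R) : Prop :=
  forall y, state_space Q y ->
    exists u_ : nat -> 'I_m -> R -> R,
      (forall n, input_in T (u_ n)) /\
      forall i, cvg_Lloc q (fun n => output Qinv P (u_ n) i) (y i).

Definition reachable Q Qinv P : Prop :=
  forall y, state_space Q y ->
    exists u, input u /\ forall i, ae_equal (output Qinv P u i) (y i).

Definition reachable_in Q Qinv P (T : R) : Prop :=
  forall y, state_space Q y ->
    exists u, input_in T u /\ forall i, ae_equal (output Qinv P u i) (y i).

(* +oo when no time is admissible *)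
Definition Tmin_qr Q Qinv P : \bar R :=
  ereal_inf [set T%:E | T in [set T : R | 0 < T /\ quasi_reachable_in Q Qinv P T]].

Definition Tmin_r Q Qinv P : \bar R :=
  ereal_inf [set T%:E | T in [set T : R | 0 < T /\ reachable_in Q Qinv P T]].

End Systems.

(* Main.v *)
Require Import Defs.
From HB Require Import structures.
From mathcomp Require Import all_boot all_order all_algebra perm.
From mathcomp Require Import all_classical all_reals all_analysis.
From mathcomp Require Import measurable_realfun ring lra.
Import Order.TTheory GRing.Theory Num.Theory.
Import numFieldNormedType.Exports.
Set Implicit Arguments.
Unset Strict Implicit.
Unset Printing Implicit Defensive.
Local Open Scope classical_set_scope.
Local Open Scope ring_scope.

(* Given an input [u], let [w = (det Q)^-1 * u] and let [psi] be the restriction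
   of [w] to [R_-]. The input [v = u - det Q * psi] is supported in [R_-], and in
   [[l(det Q), +oo[] because [v = det Q * (w - psi)] where [w - psi] is supported
   in [R_+]. The outputs of [u] and [v] agree on [R_+], since
   [Q^-1 * P * det Q * psi = adj Q * P * psi] is supported in [R_-]. Hence every
   output is the output of an input supported in [[l(det Q), 0]].

   The algebra takes place in the commutative ring of the Radon measures with
   support bounded on the left, which are the differences of two positive
   measures of that kind; a locally integrable function [f] is identified with
   the measure [f dx]. That [v] stays in [L^q] is Young's inequality, which
   follows from Hoelder's and Tonelli's theorems. *)

(** * Positive measures with support bounded on the left *)

(** The definitions evaluate a convolution through the upper variations of its left factor, that is,
    through a Jordan decomposition. The Jordan pair of a product is in general not obtained by
    convolving Jordan pairs, so associativity cannot be read off the definition. The way out is to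
    admit every pair of positive measures whose difference is the given set function: integrals do
    not depend on the pair, products of pairs are pairs, and the ring laws reduce to Tonelli's
    theorem.

    A genuine commutative ring is worth building because determinants are then multiplicative, which
    makes [det (Q^-1)] the inverse of [det Q], and because Cramer's rule becomes available. The
    correction uses [det Q] rather than [Q] since a scalar acts on inputs, commutes with [P], and
    clears the denominator of [Q^-1].

    Cutting at 0 is done on functions, where it preserves local [L^q] integrability, while supports
    and outputs are compared in the ring; equality of the measures [f dx] and [g dx] then returns
    equality almost everywhere. *)

Section LeftFinite.
Context {R : realType}.
Local Notation T := (measurableTypeR R).
Local Open Scope ereal_scope.

(** Finiteness is asked on half-lines instead of compact sets, which is equivalent once the left end
    is null, and is the form in which bounds are used. *)
Definition left_finite (m : set T -> \bar R) :=
  (exists a, m `]-oo, a[%classic = 0) /\ forall b, m `]-oo, b]%classic < +oo.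

Record lfm := LFM {
  lfm_measure :> {sigma_finite_measure set T -> \bar R};
  lfmP : left_finite lfm_measure }.

Section Make.
Variables (m : {measure set T -> \bar R}) (mP : left_finite m).

(** The alias carries the proof of left finiteness, so that the sigma-finite structure, which
    depends on it, can be inferred from the term. *)
Definition lfm_copy (_ : left_finite m) : set T -> \bar R := m.

HB.instance Definition _ := Measure.on (lfm_copy mP).

Let sigma_finite_lfm_copy : sigma_finite setT (lfm_copy mP).
Proof.
exists (fun n => `]-oo, n%:R]%classic).
  apply/seteqP; split => // x _; exists (Num.truncn `|x|).+1 => //=.
  rewrite in_itv/= (le_trans (ler_norm _))// ltW// truncnS_gt//.
by move=> n; split => //; exact: mP.2.
Qed.

HB.instance Definition _ :=
  Measure_isSigmaFinite.Build _ _ _ (lfm_copy mP) sigma_finite_lfm_copy.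

Definition mk_lfm : lfm := @LFM (lfm_copy mP) mP.

Lemma mk_lfmE A : mk_lfm A = m A. Proof. by []. Qed.

End Make.

Lemma lfm_le0 (m : lfm) (a : R) (A : set T) : m `]-oo, a[%classic = 0 -> measurable A ->
  A `<=` `]-oo, a[ -> m A = 0.
Proof.
move=> m0 mA Aa; apply/eqP; rewrite eq_le measure_ge0 andbT -m0.
by rewrite le_measure// inE.
Qed.

Lemma lfm_lty (m : lfm) (b : R) (A : set T) :
  measurable A -> A `<=` `]-oo, b] -> m A < +oo.
Proof.
move=> mA Ab; apply: le_lt_trans ((lfmP m).2 b).
by rewrite le_measure// inE.
Qed.

Lemma measure_add_lfmE (m n : lfm) A : measure_add m n A = m A + n A.
Proof. exact: measure_addE. Qed.

Lemma left_finite_add (m n : lfm) : left_finite (measure_add m n).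
Proof.
have [[a ma] mb] := lfmP m; have [[b nb] nc] := lfmP n.
split; last by move=> c; rewrite measure_add_lfmE lte_add_pinfty ?mb ?nc.
exists (Num.min a b); rewrite measure_add_lfmE.
rewrite (lfm_le0 ma)//; last by move=> x /=; rewrite !in_itv/= lt_min => /andP[].
rewrite (lfm_le0 nb) ?adde0// => x /=.
by rewrite !in_itv/= lt_min => /andP[].
Qed.

(* Opaque, as unification would otherwise unfold the integrals that define
   the measures. *)
Fact lfm_add_subdef : {add : lfm -> lfm -> lfm |
  forall m n, add m n = mk_lfm (left_finite_add m n)}.
Proof. by eexists. Qed.

Definition lfm_add : lfm -> lfm -> lfm := sval lfm_add_subdef.

Lemma lfm_addE m n A : lfm_add m n A = m A + n A.
Proof. by rewrite /lfm_add (svalP lfm_add_subdef) -measure_add_lfmE. Qed.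

Lemma left_finite_dirac (x : T) : left_finite (dirac x).
Proof.
split; first by exists x; rewrite diracE memNset//= in_itv/= ltxx.
by move=> b; rewrite diracE; case: (_ \in _); rewrite ltry.
Qed.

Definition lfm_dirac x : lfm := mk_lfm (left_finite_dirac x).

Lemma left_finite0 : left_finite (@mzero _ T R).
Proof. by split; [exists 0%R|move=> b; rewrite /mzero ltry]. Qed.

Definition lfm0 : lfm := mk_lfm left_finite0.

Lemma measurable_addT : measurable_fun setT (fun p : T * T => (p.1 + p.2)%R : T).
Proof. exact: measurable_funD. Qed.

(** As an image of the product measure under addition, the convolution inherits sigma-additivity;
    the formula that [mconv] uses is recovered in [lfm_convE]. *)
Definition lfm_conv_fun (m n : lfm) : set T -> \bar R :=
  pushforward (m \x n) (fun p => (p.1 + p.2)%R : T).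

Section Convolution.
Variables m n : lfm.

Let lfm_conv0 : lfm_conv_fun m n set0 = 0.
Proof. by apply: measure0; exact: measurable_addT. Qed.

Let lfm_conv_ge0 A : 0 <= lfm_conv_fun m n A.
Proof. by apply: measure_ge0; exact: measurable_addT. Qed.

Let lfm_conv_sigma_additive : semi_sigma_additive (lfm_conv_fun m n).
Proof. by apply: measure_semi_sigma_additive; exact: measurable_addT. Qed.

HB.instance Definition _ := isMeasure.Build _ _ _ (lfm_conv_fun m n)
  lfm_conv0 lfm_conv_ge0 lfm_conv_sigma_additive.

Lemma left_finite_conv : left_finite (lfm_conv_fun m n).
Proof.
have [[a ma] mb] := lfmP m; have [[b nb] nc] := lfmP n.
have pmE (A B : set T) : measurable A -> measurable B ->
  (m \x n) (A `*` B) = m A * n B by exact: product_measure1E.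
have mpre (A : set T) : measurable A ->
    measurable ((fun p : T * T => (p.1 + p.2)%R : T) @^-1` A).
  by move=> mA; rewrite -[X in measurable X]setTI; exact: measurable_addT.
have m1 : measurable (`]-oo, a[%classic `*` setT : set (T * T)).
  exact: measurableX.
have m2 : measurable (setT `*` `]-oo, b[%classic : set (T * T)).
  exact: measurableX.
have null : (m \x n) (`]-oo, a[%classic `*` setT `|` setT `*` `]-oo, b[%classic) = 0.
  apply/eqP; rewrite eq_le measure_ge0 andbT.
  apply: (le_trans (measureU2 _ _ _)) => //.
  by rewrite /= !pmE// ma nb mul0e mule0 adde0.
split.
  exists (a + b)%R; apply/eqP; rewrite eq_le measure_ge0 andbT -[leRHS]null.
  rewrite /lfm_conv_fun /pushforward.
  apply: (@le_measure _ _ _ (m \x n)); rewrite ?inE; [exact: mpre|exact: measurableU|].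
  move=> [x y]; rewrite /= !in_itv/= => xy.
  by have [xa|xa] := ltP x a; [left|right]; split; rewrite //= ?in_itv//=; lra.
move=> c.
(* If [x >= a], [y >= b] and [x + y <= c], then [x <= c - b] and [y <= c - a]: outside of the two
   null strips everything happens in the rectangle [K], whose measure is a product of two finite
   ones. *)
pose K : set (T * T) := `]-oo, (c - b)%R]%classic `*` `]-oo, (c - a)%R]%classic.
have m3 : measurable K.
  exact: measurableX.
apply: (@le_lt_trans _ _ ((m \x n) ((`]-oo, a[%classic `*` setT `|`
    setT `*` `]-oo, b[%classic) `|` K))).
  rewrite /lfm_conv_fun /pushforward.
  apply: (@le_measure _ _ _ (m \x n)); rewrite ?inE; [exact: mpre| |].
    by apply: measurableU => //; exact: measurableU.
  move=> [x y]; rewrite /= !in_itv/= => xy.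
  have [xa|xa] := ltP x a; first by left; left; split; rewrite /= ?in_itv.
  have [yb|yb] := ltP y b; first by left; right; split; rewrite /= ?in_itv.
  by right; split; rewrite /= ?in_itv/=; lra.
apply: le_lt_trans.
  by apply: (measureU2 (m \x n) _ m3); exact: measurableU.
rewrite /= null add0e /= pmE// lte_mul_pinfty//.
by rewrite ge0_fin_numE// mb.
Qed.

End Convolution.

Fact lfm_conv_subdef : {conv : lfm -> lfm -> lfm |
  forall m n, conv m n = mk_lfm (left_finite_conv m n)}.
Proof. by eexists. Qed.

Definition lfm_conv : lfm -> lfm -> lfm := sval lfm_conv_subdef.

Lemma lfm_convE m n A : lfm_conv m n A = \int[m]_t n [set x - t | x in A]%R.
Proof.
rewrite /lfm_conv (svalP lfm_conv_subdef) mk_lfmE /lfm_conv_fun /pushforward /=.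
rewrite /product_measure1.
apply: eq_integral => t _ /=; congr (n _); apply/seteqP; split => [y|_ [x Ax <-]].
  by rewrite /xsection/= inE/= => Aty; exists (t + y)%R => //; ring.
by rewrite /xsection/= inE/= addrC subrK.
Qed.

Lemma integral_lfm_conv m n (g : T -> \bar R) : measurable_fun setT g ->
  (forall x, 0 <= g x) ->
  \int[lfm_conv m n]_x g x = \int[m]_s \int[n]_t g (s + t)%R.
Proof.
move=> mg g0.
transitivity (\int[m \x n]_p g (p.1 + p.2)%R).
  rewrite /lfm_conv (svalP lfm_conv_subdef).
  rewrite [LHS](_ : _ = \int[pushforward (m \x n) (fun p => (p.1 + p.2)%R : T)]_x g x)//.
  by rewrite ge0_integral_pushforward//; exact: measurable_addT.
rewrite fubini_tonelli1//.
by apply: measurableT_comp => //; exact: measurable_addT.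
Qed.

Lemma measurable_fun_translate (m : lfm) (A : set T) : measurable A ->
  measurable_fun setT (fun t : T => m [set x - t | x in A]%R).
Proof.
move=> mA.
rewrite (_ : (fun t => _) = m \o xsection ((fun p : T * T => (p.1 + p.2)%R : T) @^-1` A)).
  apply: measurable_fun_xsection; rewrite -[X in measurable X]setTI.
  exact: measurable_addT.
apply/funext => t /=; congr (m _); apply/seteqP; split => [_ [x Ax <-]|y].
  by rewrite /xsection/= inE/= addrC subrK.
by rewrite /xsection/= inE/= => Aty; exists (t + y)%R => //; ring.
Qed.

Lemma measurable_translate (A : set T) (t : R) : measurable A ->
  measurable ([set x - t | x in A]%R : set T).
Proof.
move=> mA; rewrite (_ : [set _ | _ in _] = (fun y : T => (t + y)%R : T) @^-1` A).
  rewrite -[X in measurable X]setTI.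
  have : measurable_fun setT (fun y : T => (t + y)%R : T) by exact: measurable_funD.
  exact.
apply/seteqP; split => [_ [x Ax <-]|y Ay]/=; first by rewrite addrC subrK.
by exists (t + y)%R => //; ring.
Qed.

Lemma lfm_convC m n A : measurable A -> lfm_conv m n A = lfm_conv n m A.
Proof.
move=> mA; have mA1 : measurable_fun setT (fun x : T => (\1_A x)%:E : \bar R).
  exact/measurable_EFinP.
have mA2 : measurable_fun setT (fun p : T * T => (\1_A (p.1 + p.2)%R)%:E : \bar R).
  by apply: (measurableT_comp mA1); exact: measurable_addT.
rewrite -(setIT A) -!integral_indic//.
rewrite !integral_lfm_conv//; [|by move=> x; rewrite lee_fin..].
rewrite (@fubini_tonelli _ _ _ _ _ m n (fun p => (\1_A (p.1 + p.2)%R)%:E))//=.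
  by apply: eq_integral => t _; apply: eq_integral => s _; rewrite addrC.
Qed.

(** Both sides unfold to the integral over [s] and [t] of the [p]-measure of [A] translated by
    [s + t]. *)
Lemma lfm_convA m n p A : measurable A ->
  lfm_conv (lfm_conv m n) p A = lfm_conv m (lfm_conv n p) A.
Proof.
move=> mA; rewrite lfm_convE integral_lfm_conv//; last exact: measurable_fun_translate.
rewrite [RHS]lfm_convE; apply: eq_integral => s _; rewrite lfm_convE.
apply: eq_integral => t _; congr (p _); rewrite image_comp.
by apply: eq_imagel => x _ /=; ring.
Qed.

Lemma lfm_convDl m n p A : measurable A ->
  lfm_conv (lfm_add m n) p A = lfm_conv m p A + lfm_conv n p A.
Proof.
move=> mA; rewrite !lfm_convE /lfm_add (svalP lfm_add_subdef) -ge0_integral_measure_add//.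
exact: measurable_fun_translate.
Qed.

Lemma lfm_conv_diracl m A : measurable A -> lfm_conv (lfm_dirac 0%R) m A = m A.
Proof.
move=> mA; rewrite lfm_convE.
rewrite [LHS](_ : _ = \int[dirac (0%R : T)]_t m [set x - t | x in A]%R)//.
rewrite integral_dirac//; last exact: measurable_fun_translate.
rewrite diracT mul1e; congr (m _); rewrite -[RHS]image_id.
by apply: eq_imagel => x _; rewrite subr0.
Qed.

End LeftFinite.

(** * Locally sigma-additive set functions *)

Section LocallySigmaAdditive.
Context {R : realType}.
Local Notation T := (measurableTypeR R).
Implicit Types (mu : set R -> R) (A B : set R).

Lemma bounded_borelP A : bounded_borel A <->
  measurable A /\ exists b, A `<=` `[- b, b].
Proof.
split=> -[mA bA]; split => //.
  have [M [Mr MA]] := bA; exists (M + 1) => x Ax /=.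
  by rewrite in_itv/= -ler_norml; apply: MA => //; rewrite ltrDl.
case: bA => b Ab; exists b; split; first exact: num_real.
move=> M bM x /Ab/=; rewrite in_itv/= -ler_norml => /le_trans; apply; exact: ltW.
Qed.

Lemma bounded_borelS A B : measurable B -> B `<=` A -> bounded_borel A ->
  bounded_borel B.
Proof.
move=> mB BA /bounded_borelP[mA [b Ab]]; apply/bounded_borelP; split => //.
by exists b; exact: subset_trans Ab.
Qed.

Lemma bounded_borel_itvcc (a b : R) : bounded_borel `[a, b].
Proof.
apply/bounded_borelP; split => //; exists (`|a| + `|b|) => x /=.
rewrite !in_itv/= => /andP[ax xb]; apply/andP; split.
  by have := ler_norm (- a); have := normr_ge0 b; rewrite normrN; lra.
by have := ler_norm b; have := normr_ge0 a; lra.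
Qed.

Lemma bounded_borel0 : bounded_borel (set0 : set R).
Proof. by apply: bounded_borelS (bounded_borel_itvcc 0 0). Qed.

Lemma bounded_borelU A B :
  bounded_borel A -> bounded_borel B -> bounded_borel (A `|` B).
Proof.
move=> /bounded_borelP[mA [a Aa]] /bounded_borelP[mB [b Bb]].
apply/bounded_borelP; split; first exact: measurableU.
exists (`|a| + `|b|) => x []/= => [/Aa|/Bb] /=; rewrite !in_itv/=;
  by have := ler_norm a; have := ler_norm b; have := normr_ge0 a;
     have := normr_ge0 b; lra.
Qed.

Lemma bounded_borel_translate A t : bounded_borel A ->
  bounded_borel [set x - t | x in A].
Proof.
move=> /bounded_borelP[mA [b Ab]]; apply/bounded_borelP; split.
  exact: measurable_translate.
exists (b + `|t|) => _ [x /Ab /= + <-]; rewrite !in_itv/=.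
by have := ler_norm t; have := ler_norm (- t); rewrite normrN; lra.
Qed.

(** The common core of [radon] set functions and of differences of positive measures: series are
    real limits, and only bounded unions are considered since the total mass may be infinite in both
    signs. *)
Definition loc_sigma_additive mu := mu set0 = 0 /\
  forall F : nat -> set R, (forall n, measurable (F n)) -> trivIset setT F ->
    bounded_set (\bigcup_n F n) ->
    (fun n => \sum_(0 <= i < n) mu (F i)) @ \oo --> mu (\bigcup_n F n).

Lemma loc_additive mu A B : loc_sigma_additive mu -> bounded_borel A ->
  bounded_borel B -> A `&` B = set0 -> mu (A `|` B) = mu A + mu B.
Proof.
move=> [mu0 smu] bA bB AB; have := smu (bigcup2 A B).
rewrite bigcup2E => /(_ _ _ (bounded_borelU bA bB).2) h.
have {}h : (fun n => \sum_(0 <= i < n) mu (bigcup2 A B i)) @ \oo --> mu (A `|` B).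
  apply: h => [[|[|n]]|]; [exact: bA.1|exact: bB.1|exact: measurable0|].
  by rewrite -trivIset_bigcup2.
rewrite -(cvg_lim _ h)//; apply: cvg_lim => //.
rewrite -(cvg_shiftn 2) /=; apply: cvg_near_cst; apply: nearW => n.
rewrite addn2 2?big_nat_recl//= big1 ?addr0//.
Qed.

Lemma loc_additiveD mu A B : loc_sigma_additive mu -> bounded_borel A ->
  bounded_borel B -> B `<=` A -> mu (A `\` B) = mu A - mu B.
Proof.
move=> smu bA bB BA; rewrite -{2}(setDUK BA) loc_additive//.
- by rewrite addrC addKr.
- by apply: (bounded_borelS _ _ bA); [exact: measurableD bA.1 bB.1|exact: subDsetl].
- by rewrite setDE setIA setIAC setICr set0I.
Qed.

Lemma loc_sigma_additiveN mu : loc_sigma_additive mu ->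
  loc_sigma_additive (fun A => - mu A).
Proof.
move=> [mu0 smu]; split => [|F mF tF bF]; first by rewrite mu0 oppr0.
under eq_fun do rewrite sumrN; apply: cvgN; exact: smu.
Qed.

(* Lindeloef: off its support, [mu] is null on countably many intervals with
   rational ends. *)
Lemma loc_sigma_additive_supp mu A : loc_sigma_additive mu ->
  bounded_borel A -> A `&` supp mu = set0 -> mu A = 0.
Proof.
move=> [mu0 smu] bA Amu.
(* Quantifying over all bounded Borel subsets lets [null] survive both the intersection with [A] and
   the disjointification by [seqDU]. *)
pose null B := forall C, bounded_borel C -> C `<=` B -> mu C = 0.
pose I (pq : rat * rat) : set R := `]ratr pq.1, ratr pq.2[%classic.
pose F n := if unpickle n is Some pq then
  if `[< null (I pq) >] then A `&` I pq else set0 else set0.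
have mF n : measurable (F n).
  rewrite /F; case: unpickle => // pq; case: ifPn => // _.
  by apply: measurableI; [exact: bA.1|exact: measurable_itv].
have FA n : F n `<=` A.
  rewrite /F; case: unpickle => [pq|]; last exact: sub0set.
  by case: ifPn => _; [exact: subIsetl|exact: sub0set].
have UF : \bigcup_n F n = A.
  apply/seteqP; split => [x [n _ /FA//]|x Ax].
  have : ~ supp mu x by move=> sx; have : set0 x by rewrite -Amu.
  move=> /existsNP[U] /not_implyP[oU] /not_implyP[Ux] Unull.
  have [e /= e0 eU] : nbhs_ball x U by apply/nbhs_ballP; exact: open_nbhs_nbhs.
  have xe1 : x - e < x by lra.
  have xe2 : x < x + e by lra.
  have [p] := rat_in_itvoo xe1; have [r] := rat_in_itvoo xe2.
  rewrite !in_itv/= => /andP[xr re] /andP[ep px].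
  have Ix : I (p, r) x by rewrite /I/= in_itv/= px.
  exists (pickle (p, r)); first exact: Logic.I.
  rewrite /F pickleK; case: asboolP => [_|]; first by split.
  case => C bC CI; apply: contrapT => muC; apply: Unull; exists C; split => //.
  apply: subset_trans CI _ => y /=; rewrite /I/= in_itv/= => /andP[py yr].
  by apply: eU; rewrite /ball/= ltr_norml; apply/andP; split; lra.
have := smu (seqDU F); rewrite -seqDU_bigcup_eq UF => /(_ _ _ bA.2) h.
have {}h : (fun n => \sum_(0 <= i < n) mu (seqDU F i)) @ \oo --> mu A.
  apply: h => [n|]; last exact: trivIset_seqDU.
  by apply: measurableD => //; exact: bigsetU_measurable.
rewrite -(cvg_lim _ h)//; apply: cvg_lim => //.
rewrite (_ : (fun _ => _) = cst 0); first exact: cvg_cst.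
apply/funext => n; rewrite big1// => i _.
have SF : seqDU F i `<=` F i by exact: subDsetl.
have nF : null (F i).
  rewrite /F; case: (unpickle i) => [pq|]; first case: asboolP => [nI|_].
  - by move=> C bC CI; apply: nI => //; apply: subset_trans CI _; exact: subIsetr.
  - by move=> C _; rewrite subset0 => ->.
  - by move=> C _; rewrite subset0 => ->.
apply: nF => //; apply: bounded_borelS bA; last exact: subset_trans (FA i).
by apply: measurableD => //; exact: bigsetU_measurable.
Qed.

End LocallySigmaAdditive.

(** * The upper variation *)

Section UpperVariation.
Context {R : realType}.
Local Notation T := (measurableTypeR R).
Implicit Types (mu : set R -> R) (A B : set R).
Local Open Scope ereal_scope.

Lemma upvar_ge mu A B : bounded_borel B -> B `<=` A -> (mu B)%:E <= upvar mu A.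
Proof. by move=> bB BA; apply: ereal_sup_ubound; exists B. Qed.

Lemma upvar_le mu A (x : \bar R) :
  (forall B, bounded_borel B -> B `<=` A -> (mu B)%:E <= x) -> upvar mu A <= x.
Proof. by move=> h; apply: ge_ereal_sup => _ [B [bB BA] <-]; exact: h. Qed.

Lemma upvarS mu A B : A `<=` B -> upvar mu A <= upvar mu B.
Proof.
by move=> AB; apply: upvar_le => C bC CA; apply: upvar_ge => //; exact: subset_trans AB.
Qed.

Section Measure.
Variables (mu : set R -> R) (smu : loc_sigma_additive mu).

Definition upvar_copy of loc_sigma_additive mu : set T -> \bar R := upvar mu.

Let upvar0 : upvar_copy smu set0 = 0.
Proof.
apply/eqP; rewrite eq_le; apply/andP; split.
  by apply: upvar_le => B _; rewrite subset0 => ->; rewrite smu.1.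
have := @upvar_ge mu set0 set0 bounded_borel0 (sub0set _).
by rewrite smu.1.
Qed.

Let upvar_ge0 A : 0 <= upvar_copy smu A.
Proof. by rewrite -upvar0; apply: upvarS; exact: sub0set. Qed.

Let upvarU A B : A `&` B = set0 -> upvar mu A + upvar mu B <= upvar mu (A `|` B).
Proof.
move=> AB; have [Aoo|Aoo] := eqVneq (upvar mu A) +oo.
  by rewrite (_ : upvar mu (A `|` B) = +oo) ?leey//; apply/eqP;
    rewrite -leye_eq -Aoo; apply: upvarS; exact: subsetUl.
have Afin : upvar mu A \is a fin_num.
  by rewrite ge0_fin_numE ?lt_neqAle ?Aoo ?leey//; exact: upvar_ge0.
rewrite addeC -leeBrDr//; apply: upvar_le => C bC CB.
rewrite leeBrDr// addeC -leeBrDr//; apply: upvar_le => D bD DA.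
rewrite leeBrDr// -EFinD -loc_additive//; last first.
  by apply/seteqP; split => // x [/DA Ax /CB Bx]; rewrite -AB.
by apply: upvar_ge; [exact: bounded_borelU|exact: setUSS].
Qed.

(** For the upper bound, a competitor [B] inside the union is cut along the [F i], and [mu B] is the
    sum of the pieces. For the lower bound, superadditivity [upvarU] bounds each partial sum by the
    value on a finite union. *)
Let upvar_sigma_additive : semi_sigma_additive (upvar_copy smu).
Proof.
move=> F mF tF mUF; rewrite /upvar_copy.
rewrite (_ : upvar mu (\bigcup_n F n) = \sum_(0 <= i <oo) upvar mu (F i)).
  by apply: is_cvg_nneseries => n _ _; exact: upvar_ge0.
apply/eqP; rewrite eq_le; apply/andP; split.
  apply: upvar_le => B bB BF.
  have : (fun n => \sum_(0 <= i < n) mu (B `&` F i))%R @ \oo --> mu B.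
    rewrite -[in mu B](setIidl BF) setI_bigcupr; apply: smu.2.
    - by move=> n; apply: measurableI; [exact: bB.1|exact: mF].
    - exact: trivIset_setIl.
    - by rewrite -setI_bigcupr (setIidl BF); exact: bB.2.
  move=> h.
  have {}h : (fun n => \sum_(0 <= i < n) (mu (B `&` F i))%:E) @ \oo --> (mu B)%:E.
    apply: cvg_EFin; first by apply: nearW => n; rewrite sumEFin.
    by under eq_fun do rewrite /= sumEFin/=; exact: h.
  rewrite -(cvg_lim _ h)//; apply: lee_lim.
  - by apply/cvg_ex; eexists; exact: h.
  - by apply: is_cvg_nneseries => n _ _; exact: upvar_ge0.
  - apply: nearW => n; apply: lee_sum => i _; apply: upvar_ge; last exact: subIsetr.
    by apply: (bounded_borelS _ _ bB); [exact: measurableI bB.1 (mF i)|exact: subIsetl].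
apply: lime_le; first by apply: is_cvg_nneseries => n _ _; exact: upvar_ge0.
apply: nearW => n; apply: (@le_trans _ _ (upvar mu (\big[setU/set0]_(i < n) F i))).
  elim: n => [|n ih]; first by rewrite big_nil; exact: upvar_ge0.
  rewrite big_nat_recr//= big_ord_recr/=; apply: le_trans (upvarU _).
    by rewrite leeD2r.
  rewrite big_distrl/= big1// => i _.
  by move/trivIsetP : tF => /(_ i n Logic.I Logic.I); apply; rewrite neq_ltn ltn_ord.
by apply: upvarS; exact: bigsetU_bigcup.
Qed.

HB.instance Definition _ := isMeasure.Build _ _ _ (upvar_copy smu)
  upvar0 upvar_ge0 upvar_sigma_additive.

Hypothesis lf : left_finite (upvar mu).

Definition upvar_lfm : lfm := mk_lfm (lf : left_finite (upvar_copy smu)).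

(** Jordan decomposition without a Hahn set: replacing [B] by its complement in [A] turns [- mu B]
    into [mu] of the complement minus [mu A], so the two suprema differ by [mu A]. Left finiteness
    makes them finite, hence subtractable. *)
Lemma upvarN A : bounded_borel A ->
  mu A = (fine (upvar mu A) - fine (upvar (fun B => - mu B) A))%R.
Proof.
move=> bA; have Afin : upvar mu A \is a fin_num.
  rewrite ge0_fin_numE; last exact: upvar_ge0.
  have /bounded_borelP[mA [b Ab]] := bA.
  apply: le_lt_trans (lf.2 b); apply: upvarS; apply: subset_trans Ab _ => x /=.
  by rewrite !in_itv/= => /andP[].
suff -> : upvar (fun B => - mu B)%R A = upvar mu A - (mu A)%:E.
  by rewrite fineB//=; ring.
apply/eqP; rewrite eq_le; apply/andP; split.
  apply: upvar_le => B bB BA; rewrite leeBrDr// -EFinD addrC -loc_additiveD//.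
  apply: upvar_ge; last exact: subDsetl.
  by apply: (bounded_borelS _ _ bA); [exact: measurableD bA.1 bB.1|exact: subDsetl].
rewrite leeBlDr//; apply: upvar_le => B bB BA; rewrite -leeBlDr// -EFinB.
have -> : (mu B - mu A = - mu (A `\` B))%R by rewrite loc_additiveD//; ring.
apply: (@upvar_ge (fun B => - mu B)%R); last exact: subDsetl.
by apply: (bounded_borelS _ _ bA); [exact: measurableD bA.1 bB.1|exact: subDsetl].
Qed.

End Measure.
End UpperVariation.

(** * Differences of positive measures *)

Section Representation.
Context {R : realType}.
Local Notation T := (measurableTypeR R).
Implicit Types (mu nu : set R -> R) (A B : set R) (m : @lfm R).
Local Open Scope ereal_scope.

Lemma lfm_fin m A : bounded_borel A -> m A \is a fin_num.
Proof.
move=> /bounded_borelP[mA [b Ab]]; rewrite ge0_fin_numE ?measure_ge0//.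
apply: (@lfm_lty _ m b) => //; apply: subset_trans Ab _ => x /=.
by rewrite !in_itv/= => /andP[].
Qed.

Lemma cvg_series_fine (u : nat -> \bar R) (l : \bar R) :
  (forall i, u i \is a fin_num) -> l \is a fin_num ->
  (fun n => \sum_(0 <= i < n) u i) @ \oo --> l ->
  (fun n => \sum_(0 <= i < n) fine (u i))%R @ \oo --> fine l.
Proof.
move=> ufin lfin ul; have {}ul : (fun n => \sum_(0 <= i < n) u i) @ \oo --> (fine l)%:E.
  by rewrite fineK.
rewrite [X in X @ _ --> _](_ : _ = fine \o (fun n => \sum_(0 <= i < n) u i)).
  exact: fine_cvg ul.
by apply/funext => n /=; rewrite sum_fine.
Qed.

Definition lfm_repr mu m (n : @lfm R) :=
  forall A, bounded_borel A -> mu A = (fine (m A) - fine (n A))%R.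

Definition lfm_diff mu := exists m n, lfm_repr mu m n.

Lemma lfm_reprN mu m n : lfm_repr mu m n -> lfm_repr (fun A => - mu A)%R n m.
Proof. by move=> mumn A bA; rewrite mumn// opprB. Qed.

Lemma lfm_repr_additive mu m n : lfm_repr mu m n -> loc_sigma_additive mu.
Proof.
move=> mumn; split => [|F mF tF bF].
  by rewrite mumn ?measure0 ?subrr//; exact: bounded_borel0.
have bUF : bounded_borel (\bigcup_n F n) by split => //; exact: bigcupT_measurable.
have bFi i : bounded_borel (F i).
  by apply: (bounded_borelS _ _ bUF) => // x Fx; exists i.
have cvg_lfm (l : lfm) :
    (fun k => \sum_(0 <= i < k) fine (l (F i)))%R @ \oo --> fine (l (\bigcup_n F n)).
  apply: cvg_series_fine; [by move=> i; exact: lfm_fin|exact: lfm_fin|].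
  exact: (@measure_semi_sigma_additive _ _ _ l F mF tF bUF.1).
rewrite mumn//; rewrite [X in X @ _ --> _](_ : _ = (fun k =>
  \sum_(0 <= i < k) fine (m (F i)) - \sum_(0 <= i < k) fine (n (F i)))%R); last first.
  by apply/funext => k; rewrite -sumrB; apply: eq_bigr => i _; exact: mumn.
by apply: cvgB; exact: cvg_lfm.
Qed.

(** Minimality of the Jordan decomposition. It transfers finiteness and integrability from any
    representing pair to the upper variations. *)
Lemma upvar_le_lfm mu m n A : lfm_repr mu m n -> measurable A -> upvar mu A <= m A.
Proof.
move=> mumn mA; apply: upvar_le => B bB BA; rewrite mumn//.
apply: (@le_trans _ _ (m B)); last by rewrite le_measure// inE//; exact: bB.1.
by rewrite -[leRHS]fineK ?lfm_fin// lee_fin lerBlDr lerDl fine_ge0.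
Qed.

Lemma left_finite_upvar mu m n : lfm_repr mu m n -> left_finite (upvar mu).
Proof.
move=> mumn; have smu := lfm_repr_additive mumn.
have [[a ma] mb] := lfmP m; split.
  exists a; apply/eqP; rewrite eq_le (@measure_ge0 _ _ _ (upvar_copy smu)) andbT.
  by rewrite -ma (upvar_le_lfm mumn).
by move=> b; apply: le_lt_trans (mb b); exact: (upvar_le_lfm mumn).
Qed.

Lemma lfm_diff_upvar mu : lfm_diff mu -> exists m n, [/\ lfm_repr mu m n,
  m = upvar mu :> (set T -> \bar R) &
  n = upvar (fun A => - mu A)%R :> (set T -> \bar R)].
Proof.
move=> [m [n mumn]]; have smu := lfm_repr_additive mumn.
have lf := left_finite_upvar mumn.
have smu' := lfm_repr_additive (lfm_reprN mumn).
have lf' := left_finite_upvar (lfm_reprN mumn).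
exists (upvar_lfm smu lf), (upvar_lfm smu' lf'); split => //.
by move=> A bA; exact: upvarN.
Qed.

Lemma radon_loc_sigma_additive mu : radon mu -> loc_sigma_additive mu.
Proof.
move=> rmu; have charge_on b : exists nu : {charge set T -> \bar R},
  forall A, measurable A -> A `<=` `[(- b)%R, b]%classic -> nu A = (mu A)%:E.
  by apply: rmu; exact: segment_compact.
split => [|F mF tF bF].
  have [nu nuE] := charge_on 0%R; have := nuE set0 measurable0 (sub0set _).
  by rewrite charge0 => -[].
have bUF : bounded_borel (\bigcup_n F n) by split => //; exact: bigcupT_measurable.
have /bounded_borelP[_ [b Fb]] := bUF.
have [nu nuE] := charge_on b.
have muE A : measurable A -> A `<=` \bigcup_n F n -> mu A = fine (nu A).
  by move=> mA AF; rewrite nuE//; exact: subset_trans Fb.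
rewrite muE//; last exact: bUF.1.
have muFE i : mu (F i) = fine (nu (F i)).
  by apply: muE => // x Fx; exists i.
under eq_fun do under eq_bigr do rewrite muFE.
apply: cvg_series_fine; [by move=> i; apply: fin_num_measure; exact: mF|
  by apply: fin_num_measure; exact: bUF.1|].
exact: (@charge_semi_sigma_additive _ _ _ nu F mF tF bUF.1).
Qed.

(** By [upvarN], only the left finiteness of the two upper variations is at stake. Left of [a] the
    set function is null, being off its support; on [[a, b]] it is a charge, and the mass of the
    positive set of a Hahn decomposition bounds the supremum. *)
Lemma M_plus_lfm_diff mu : M_plus mu -> lfm_diff mu.
Proof.
move=> [rmu [a smua]]; have smu := radon_loc_sigma_additive rmu.
have lf : forall nu, radon nu -> loc_sigma_additive nu ->
    (forall B, bounded_borel B -> B `<=` `]-oo, a[%classic -> nu B = 0%R) ->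
    left_finite (upvar nu).
  move=> nu rnu snu nu0; split.
    exists a; apply/eqP; rewrite eq_le (@measure_ge0 _ _ _ (upvar_copy snu)) andbT.
    by apply: upvar_le => B bB Ba; rewrite nu0.
  move=> b; have [l lE] := rnu _ (@segment_compact _ a b).
  have [P [N [[mP Ppos] [mN Nneg] PN PN0]]] := Hahn_decomposition l.
  have lfin A : measurable A -> l A \is a fin_num by move=> mA; apply: fin_num_measure.
  apply: (@le_lt_trans _ _ (l P)); last by rewrite ltey_eq lfin.
  apply: upvar_le => B bB Bb.
  have mB := bB.1.
  have mBa : measurable (B `&` `]-oo, a[%classic) by exact: measurableI.
  have mBab : measurable (B `&` `[a, b]%classic) by exact: measurableI.
  have bBa : bounded_borel (B `&` `]-oo, a[%classic).
    by apply: (bounded_borelS mBa _ bB); exact: subIsetl.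
  have bBab : bounded_borel (B `&` `[a, b]%classic).
    by apply: (bounded_borelS mBab _ bB); exact: subIsetl.
  have BE : B = (B `&` `]-oo, a[%classic) `|` (B `&` `[a, b]%classic).
    rewrite -setIUr; apply/esym/setIidl => x /Bb/=; rewrite !in_itv/= => xb.
    by have [xa|xa] := ltP x a; [left|right]; rewrite /= ?in_itv/= ?xa ?xb.
  have B0 : (B `&` `]-oo, a[%classic) `&` (B `&` `[a, b]%classic) = set0.
    apply/seteqP; split => // x [[_]] /=; rewrite in_itv/= => xa [_] /=.
    by rewrite in_itv/= leNgt xa.
  have {BE B0}-> : nu B = nu (B `&` `[a, b]%classic).
    rewrite {1}BE loc_additive// nu0 ?add0r//; exact: subIsetr.
  rewrite -lE//.
  set C := B `&` _ in mBab *.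
  have mCP : measurable (C `&` P) by exact: measurableI.
  have mCN : measurable (C `&` N) by exact: measurableI.
  have mPC : measurable (P `\` C) by exact: measurableD.
  rewrite (charge_partition l mBab mP mN PN PN0).
  have -> : l P = l (C `&` P) + l (P `\` C).
    by rewrite addeC (chargeD l mP mBab) setIC subeK// lfin.
  apply: leeD2l; apply: (@le_trans _ _ 0).
    by apply: Nneg => //; exact: subIsetr.
  by apply: Ppos => //; exact: subDsetl.
have nsupp_lt B : bounded_borel B -> B `<=` `]-oo, a[%classic -> mu B = 0%R.
  move=> bB Ba; apply: loc_sigma_additive_supp => //.
  apply/seteqP; split => // x [/Ba /=]; rewrite in_itv/= => xa /smua/=.
  by rewrite in_itv/= andbT leNgt xa.
have radonN : radon (fun A => - mu A)%R.
  move=> K cK; have [l lE] := rmu K cK.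
  by exists (copp l) => A mA AK; exact: (congr1 oppe (lE A mA AK)).
have smuN := loc_sigma_additiveN smu.
have lfmu := lf _ rmu smu nsupp_lt.
have lfmuN : left_finite (upvar (fun A => - mu A)%R).
  by apply: lf => // B bB Ba; rewrite nsupp_lt// oppr0.
by exists (upvar_lfm smu lfmu), (upvar_lfm smuN lfmuN) => A bA; exact: upvarN.
Qed.

End Representation.

(** * Integrals and convolutions computed from any representing pair *)

Section ConvolutionRepresentation.
Context {R : realType}.
Local Notation T := (measurableTypeR R).
Implicit Types (mu nu : set R -> R) (A B : set R) (m : @lfm R).
Local Open Scope ereal_scope.

Lemma lfm_eq m (n : @lfm R) : (forall A, bounded_borel A -> m A = n A) ->
  forall A : set T, measurable A -> m A = n A.
Proof.
move=> mn A mA; pose F k := A `&` `[(- k%:R)%R, k%:R%R]%classic.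
have mF k : measurable (F k) by exact: measurableI.
have UF : \bigcup_k F k = A.
  rewrite -setI_bigcupr; apply/setIidl => x _; exists (Num.truncn `|x|).+1 => //=.
  by rewrite in_itv/= -ler_norml ltW// truncnS_gt.
have ndF : {homo F : i j / (i <= j)%N >-> (i <= j)%O}.
  move=> i j ij; apply/subsetPset => x [Ax /=]; rewrite in_itv/= -ler_norml => xi.
  by split => //=; rewrite in_itv/= -ler_norml (le_trans xi)// ler_nat.
have cvgF (l : @lfm R) : l \o F @ \oo --> l A.
  have := @nondecreasing_cvg_mu _ _ _ l F mF.
  by rewrite UF => /(_ mA ndF).
rewrite -(cvg_lim _ (cvgF m))// -(cvg_lim _ (cvgF n))//.
rewrite (_ : m \o F = n \o F)//; apply/funext => k /=; apply: mn.
apply: (bounded_borelS (mF k) _ (bounded_borel_itvcc (- k%:R) k%:R)).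
exact: subIsetr.
Qed.

Lemma fine_lfm_add m (n : @lfm R) A : bounded_borel A ->
  fine (lfm_add m n A) = (fine (m A) + fine (n A))%R.
Proof. by move=> bA; rewrite lfm_addE fineD// lfm_fin. Qed.

(** Uniqueness is written with crossed sums because the differences are meaningless on sets where
    both members are infinite; equality on bounded sets then extends to all measurable sets by
    exhaustion. *)
Lemma lfm_repr_unique mu m1 m2 n1 n2 : lfm_repr mu m1 m2 -> lfm_repr mu n1 n2 ->
  forall A : set T, measurable A -> lfm_add m1 n2 A = lfm_add n1 m2 A.
Proof.
move=> mum mun; apply: lfm_eq => A bA; rewrite !lfm_addE.
rewrite -[m1 A]fineK ?lfm_fin// -[n2 A]fineK ?lfm_fin//.
rewrite -[n1 A]fineK ?lfm_fin// -[m2 A]fineK ?lfm_fin//.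
rewrite -!EFinD; congr (_%:E); have := mum _ bA; rewrite mun//.
by move=> h; lra.
Qed.

Lemma integral_lfm_repr mu m1 m2 n1 n2 (g : T -> \bar R) :
  lfm_repr mu m1 m2 -> lfm_repr mu n1 n2 ->
  m1.-integrable setT g -> m2.-integrable setT g ->
  n1.-integrable setT g -> n2.-integrable setT g ->
  (fine (\int[m1]_x g x) - fine (\int[m2]_x g x))%R =
  (fine (\int[n1]_x g x) - fine (\int[n2]_x g x))%R.
Proof.
move=> mum mun gm1 gm2 gn1 gn2.
have h : \int[m1]_x g x + \int[n2]_x g x = \int[n1]_x g x + \int[m2]_x g x.
  rewrite -!integral_measure_add//.
  apply: eq_measure_integral => A mA _.
  by have := lfm_repr_unique mum mun mA; rewrite !lfm_addE -!measure_add_lfmE.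
have aux (a b c e : \bar R) : a \is a fin_num -> b \is a fin_num ->
    c \is a fin_num -> e \is a fin_num -> a + e = c + b ->
    (fine a - fine b = fine c - fine e)%R.
  by case: a b c e => [a||] [b||] [c||] [e||]// _ _ _ _ /= [] ace; lra.
by apply: aux h; exact: integrable_fin_num.
Qed.

(** The pair of upper variations is dominated by [m1], [m2], so [g] is integrable against it too,
    and the two differences of integrals agree by the crossed-sum identity. *)
Lemma integral_against_repr mu m1 m2 (g : R -> R) : lfm_repr mu m1 m2 ->
  m1.-integrable setT (EFin \o g) -> m2.-integrable setT (EFin \o g) ->
  integral_against mu g =
  (fine (\int[m1]_x (g x)%:E) - fine (\int[m2]_x (g x)%:E))%R.
Proof.
move=> mum gm1 gm2.
have [n1 [n2 [mun n1E n2E]]] : exists m n, [/\ lfm_repr mu m n,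
    m = upvar mu :> (set T -> \bar R) &
    n = upvar (fun A => - mu A)%R :> (set T -> \bar R)].
  by apply: lfm_diff_upvar; exists m1, m2.
rewrite /integral_against -n1E -n2E.
have mono (l k : @lfm R) : (forall A : set T, measurable A -> l A <= k A) ->
    k.-integrable setT (EFin \o g) -> l.-integrable setT (EFin \o g).
  move=> lk /integrableP[mg kg]; apply/integrableP; split => //.
  apply: le_lt_trans kg; apply: ge0_le_measure_integral => //.
  exact: measurableT_comp.
apply: (integral_lfm_repr mun mum) => //.
- by apply: mono gm1 => A mA; rewrite n1E; exact: (upvar_le_lfm mum).
- by apply: mono gm2 => A mA; rewrite n2E; exact: (upvar_le_lfm (lfm_reprN mum)).
Qed.

Section Translate.
Variables (m n : @lfm R) (A : set R).
Hypothesis bA : bounded_borel A.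

Lemma integrable_translate :
  m.-integrable setT (fun t : T => n [set x - t | x in A]%R).
Proof.
apply/integrableP; split; first exact: measurable_fun_translate bA.1.
rewrite (eq_integral (fun t : T => n [set x - t | x in A]%R)); last first.
  by move=> t _; rewrite gee0_abs.
by rewrite -lfm_convE ltey_eq lfm_fin.
Qed.

End Translate.

(** The expansion of [m1 - m2] times [n1 - n2]. Every ring law below is checked on such pairs, where
    it holds for positive measures. *)
Lemma mconv_repr mu nu m1 m2 n1 n2 : lfm_repr mu m1 m2 -> lfm_repr nu n1 n2 ->
  lfm_repr (mconv mu nu)
    (lfm_add (lfm_conv m1 n1) (lfm_conv m2 n2))
    (lfm_add (lfm_conv m1 n2) (lfm_conv m2 n1)).
Proof.
move=> mum nun A bA.
have gE t : (nu [set x - t | x in A]%R)%:E =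
    n1 [set x - t | x in A]%R - n2 [set x - t | x in A]%R.
  have bAt := bounded_borel_translate t bA.
  by rewrite nun// EFinB !fineK// lfm_fin.
have gint (m : @lfm R) :
    m.-integrable setT (EFin \o (fun t => nu [set x - t | x in A]%R)).
  rewrite (_ : EFin \o _ = fun t : T => n1 [set x - t | x in A]%R -
    n2 [set x - t | x in A]%R); last by apply/funext => t; exact: gE.
  by apply: integrableB => //; exact: integrable_translate.
have gintE (m : @lfm R) : fine (\int[m]_t (nu [set x - t | x in A]%R)%:E) =
    (fine (lfm_conv m n1 A) - fine (lfm_conv m n2 A))%R.
  under eq_integral do rewrite gE.
  rewrite integralB//; [|exact: integrable_translate..].
  by rewrite -!lfm_convE fineB// lfm_fin.
rewrite /mconv (integral_against_repr mum)// !gintE !fine_lfm_add//.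
ring.
Qed.

End ConvolutionRepresentation.

(** * The convolution ring *)

Section FineConvolution.
Context {R : realType}.
Implicit Types (A B : set R) (m n p : @lfm R).

Lemma fine_lfm_convC m n A : bounded_borel A ->
  fine (lfm_conv m n A) = fine (lfm_conv n m A).
Proof. by move=> [mA _]; rewrite lfm_convC. Qed.

Lemma fine_lfm_convA m n p A : bounded_borel A ->
  fine (lfm_conv (lfm_conv m n) p A) = fine (lfm_conv m (lfm_conv n p) A).
Proof. by move=> [mA _]; rewrite lfm_convA. Qed.

Lemma fine_lfm_convDl m n p A : bounded_borel A ->
  fine (lfm_conv (lfm_add m n) p A) =
  fine (lfm_conv m p A) + fine (lfm_conv n p A).
Proof. by move=> bA; rewrite lfm_convDl; [rewrite fineD// lfm_fin|exact: bA.1]. Qed.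

Lemma fine_lfm_convDr m n p A : bounded_borel A ->
  fine (lfm_conv p (lfm_add m n) A) =
  fine (lfm_conv p m A) + fine (lfm_conv p n A).
Proof.
by move=> bA; rewrite fine_lfm_convC// fine_lfm_convDl// [in LHS]fine_lfm_convC//
  [X in _ + X]fine_lfm_convC.
Qed.

Lemma lfm_conv0l m (A : set R) : lfm_conv lfm0 m A = 0%E.
Proof. by rewrite lfm_convE [LHS](integral_measure_zero _). Qed.

End FineConvolution.

Section LocalMeasureRing.
Context {R : realType}.
Implicit Types (mu nu : set R -> R) (A B : set R).

(* The values outside of the bounded Borel sets are fixed in order to turn
   [meas_eq] into equality. *)
Record lmeas := LMeas {
  lmeas_fun :> set R -> R;
  lmeas_diff : lfm_diff lmeas_fun;
  lmeas_out : forall A, ~ bounded_borel A -> lmeas_fun A = 0 }.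

HB.instance Definition _ := gen_eqMixin lmeas.
HB.instance Definition _ := gen_choiceMixin lmeas.

Lemma lmeasP (x y : lmeas) : (forall A, bounded_borel A -> x A = y A) -> x = y.
Proof.
case: x y => [x dx ox] [y dy oy] /= xy.
have {}xy : x = y.
  apply/funext => A; have [bA|bA] := pselect (bounded_borel A); first exact: xy.
  by rewrite ox// oy.
by case: y / xy dy oy => dy oy; congr LMeas; exact: Prop_irrelevance.
Qed.

Section Make.
Variables (mu : set R -> R) (dmu : lfm_diff mu).

Let f A := if `[< bounded_borel A >] then mu A else 0.

Let fE A : bounded_borel A -> f A = mu A.
Proof. by move=> bA; rewrite /f; case: asboolP. Qed.

Let df : lfm_diff f.
Proof. by have [m [n mn]] := dmu; exists m, n => A bA; rewrite fE ?mn. Qed.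

Let f0 A : ~ bounded_borel A -> f A = 0.
Proof. by move=> bA; rewrite /f; case: asboolP. Qed.

Definition mk_lmeas := LMeas df f0.

Lemma mk_lmeasE A : bounded_borel A -> mk_lmeas A = mu A.
Proof. exact: fE. Qed.

End Make.

Lemma lfm_diffD mu nu : lfm_diff mu -> lfm_diff nu -> lfm_diff (fun A => mu A + nu A).
Proof.
move=> [m1 [m2 mum]] [n1 [n2 nun]]; exists (lfm_add m1 n1), (lfm_add m2 n2).
by move=> A bA; rewrite mum// nun// !fine_lfm_add//; ring.
Qed.

Lemma lfm_diffN mu : lfm_diff mu -> lfm_diff (fun A => - mu A).
Proof. by move=> [m [n mn]]; exists n, m; exact: lfm_reprN. Qed.

Lemma lfm_diff0 : lfm_diff (fun=> 0 : R).
Proof. by exists lfm0, lfm0 => A bA; rewrite subrr. Qed.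

Lemma delta0_repr : lfm_repr (@delta0 R) (lfm_dirac 0) lfm0.
Proof. by move=> A bA; rewrite mk_lfmE [fine (lfm0 _)](_ : _ = 0)// subr0. Qed.

Lemma lfm_diff_delta0 : lfm_diff (@delta0 R).
Proof. by exists (lfm_dirac 0), lfm0; exact: delta0_repr. Qed.

Lemma lfm_diff_mconv mu nu : lfm_diff mu -> lfm_diff nu -> lfm_diff (mconv mu nu).
Proof.
by move=> [m1 [m2 mum]] [n1 [n2 nun]]; do 2 eexists; exact: mconv_repr mum nun.
Qed.

Definition lmeas_add (x y : lmeas) := mk_lmeas (lfm_diffD (lmeas_diff x) (lmeas_diff y)).
Definition lmeas_opp (x : lmeas) := mk_lmeas (lfm_diffN (lmeas_diff x)).
Definition lmeas0 := mk_lmeas lfm_diff0.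
Definition lmeas1 := mk_lmeas lfm_diff_delta0.
Definition lmeas_mul (x y : lmeas) :=
  mk_lmeas (lfm_diff_mconv (lmeas_diff x) (lmeas_diff y)).

Let lmeas_addA : associative lmeas_add.
Proof. by move=> x y z; apply: lmeasP => A bA; rewrite !mk_lmeasE// addrA. Qed.

Let lmeas_addC : commutative lmeas_add.
Proof. by move=> x y; apply: lmeasP => A bA; rewrite !mk_lmeasE// addrC. Qed.

Let lmeas_add0 : left_id lmeas0 lmeas_add.
Proof. by move=> x; apply: lmeasP => A bA; rewrite !mk_lmeasE// add0r. Qed.

Let lmeas_addN : left_inverse lmeas0 lmeas_opp lmeas_add.
Proof. by move=> x; apply: lmeasP => A bA; rewrite !mk_lmeasE// addNr. Qed.

HB.instance Definition _ :=
  GRing.isZmodule.Build lmeas lmeas_addA lmeas_addC lmeas_add0 lmeas_addN.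

Lemma lmeas_mul_repr (x y : lmeas) m1 m2 n1 n2 :
  lfm_repr x m1 m2 -> lfm_repr y n1 n2 ->
  lfm_repr (lmeas_mul x y)
    (lfm_add (lfm_conv m1 n1) (lfm_conv m2 n2))
    (lfm_add (lfm_conv m1 n2) (lfm_conv m2 n1)).
Proof. by move=> xm yn A bA; rewrite mk_lmeasE// (mconv_repr xm yn bA). Qed.

Lemma lmeas_add_repr (x y : lmeas) m1 m2 n1 n2 :
  lfm_repr x m1 m2 -> lfm_repr y n1 n2 ->
  lfm_repr (lmeas_add x y) (lfm_add m1 n1) (lfm_add m2 n2).
Proof.
by move=> xm yn A bA; rewrite mk_lmeasE// xm// yn// !fine_lfm_add//; ring.
Qed.

Let fineE := (@fine_lfm_add R, @fine_lfm_convDl R, @fine_lfm_convDr R).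

Let lmeas_mulC : commutative lmeas_mul.
Proof.
move=> x y; apply: lmeasP => A bA.
have [x1 [x2 xE]] := lmeas_diff x; have [y1 [y2 yE]] := lmeas_diff y.
rewrite (lmeas_mul_repr xE yE)// (lmeas_mul_repr yE xE)// !fineE//.
rewrite (fine_lfm_convC y1 x1 bA) (fine_lfm_convC y2 x2 bA).
rewrite (fine_lfm_convC y1 x2 bA) (fine_lfm_convC y2 x1 bA).
ring.
Qed.

Let lmeas_mulA : associative lmeas_mul.
Proof.
move=> x y z; apply: lmeasP => A bA.
have [x1 [x2 xE]] := lmeas_diff x; have [y1 [y2 yE]] := lmeas_diff y.
have [z1 [z2 zE]] := lmeas_diff z.
rewrite (lmeas_mul_repr xE (lmeas_mul_repr yE zE))//.
rewrite (lmeas_mul_repr (lmeas_mul_repr xE yE) zE)// !fineE//.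
rewrite !fine_lfm_convA//; ring.
Qed.

Let lmeas_mul1 : left_id lmeas1 lmeas_mul.
Proof.
move=> x; apply: lmeasP => A bA; have [x1 [x2 xE]] := lmeas_diff x.
rewrite (@lmeas_mul_repr lmeas1 x (lfm_dirac 0) lfm0 _ _ _ xE)//; last first.
  by move=> B bB; rewrite mk_lmeasE// delta0_repr.
rewrite !fineE// !lfm_conv_diracl; [|exact: bA.1..].
by rewrite !lfm_conv0l/= !addr0 xE.
Qed.

Let lmeas_mulDl : left_distributive lmeas_mul lmeas_add.
Proof.
move=> x y z; apply: lmeasP => A bA.
have [x1 [x2 xE]] := lmeas_diff x; have [y1 [y2 yE]] := lmeas_diff y.
have [z1 [z2 zE]] := lmeas_diff z.
rewrite (lmeas_mul_repr (lmeas_add_repr xE yE) zE)//.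
rewrite (lmeas_add_repr (lmeas_mul_repr xE zE) (lmeas_mul_repr yE zE))// !fineE//.
ring.
Qed.

HB.instance Definition _ := GRing.Zmodule_isComPzRing.Build lmeas
  lmeas_mulA lmeas_mulC lmeas_mul1 lmeas_mulDl.

Lemma lmeasD (x y : lmeas) A : (x + y) A = x A + y A.
Proof.
have [bA|bA] := pselect (bounded_borel A); first by rewrite mk_lmeasE.
by rewrite !lmeas_out// addr0.
Qed.

Lemma lmeasN (x : lmeas) A : (- x) A = - x A.
Proof.
have [bA|bA] := pselect (bounded_borel A); first by rewrite mk_lmeasE.
by rewrite !lmeas_out// oppr0.
Qed.

Lemma lmeas0E A : (0 : lmeas) A = 0.
Proof.
have [bA|bA] := pselect (bounded_borel A); first by rewrite mk_lmeasE.
by rewrite lmeas_out.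
Qed.

Lemma lmeas_sum I (r : seq I) (P : pred I) (F : I -> lmeas) A :
  (\sum_(i <- r | P i) F i) A = \sum_(i <- r | P i) F i A.
Proof.
apply: (big_morph (fun x : lmeas => x A)); last exact: lmeas0E.
by move=> x y; rewrite lmeasD.
Qed.

Lemma lmeas_signM k (x : lmeas) A : ((-1) ^+ k * x) A = (-1) ^+ k * x A.
Proof.
elim: k => [|k ih]; first by rewrite !expr0 !mul1r.
by rewrite !exprS -!mulrA !mulN1r lmeasN ih.
Qed.

(** Made total by the default value 0, so that it can be mapped over matrices. *)
Definition to_lmeas mu : lmeas :=
  if pselect (lfm_diff mu) is left h then mk_lmeas h else 0.

Lemma to_lmeasE mu A : lfm_diff mu -> bounded_borel A -> to_lmeas mu A = mu A.
Proof. by rewrite /to_lmeas => dmu bA; case: pselect => // h; rewrite mk_lmeasE. Qed.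

Lemma to_lmeas_repr mu m n : lfm_repr mu m n -> lfm_repr (to_lmeas mu) m n.
Proof.
by move=> mumn A bA; rewrite to_lmeasE ?mumn//; exists m, n.
Qed.

Lemma to_lmeas_mconv mu nu : lfm_diff mu -> lfm_diff nu ->
  to_lmeas (mconv mu nu) = to_lmeas mu * to_lmeas nu.
Proof.
move=> dmu dnu; have dmn := lfm_diff_mconv dmu dnu.
have [m1 [m2 mum]] := dmu; have [n1 [n2 nun]] := dnu.
apply: lmeasP => A bA; rewrite to_lmeasE// (mconv_repr mum nun bA).
by rewrite (lmeas_mul_repr (to_lmeas_repr mum) (to_lmeas_repr nun) bA).
Qed.

Lemma lfm_diff_sum I (r : seq I) (P : pred I) (F : I -> set R -> R) :
  (forall i, P i -> lfm_diff (F i)) -> lfm_diff (fun A => \sum_(i <- r | P i) F i A).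
Proof.
move=> dF; elim: r => [|i r ih].
  by under eq_fun do rewrite big_nil; exact: lfm_diff0.
under eq_fun do rewrite big_cons.
case Pi : (P i) => //.
by apply: lfm_diffD => //; exact: dF.
Qed.

Lemma to_lmeas_sum I (r : seq I) (P : pred I) (F : I -> set R -> R) :
  (forall i, P i -> lfm_diff (F i)) ->
  to_lmeas (fun A => \sum_(i <- r | P i) F i A) = \sum_(i <- r | P i) to_lmeas (F i).
Proof.
move=> dF; apply: lmeasP => A bA; rewrite to_lmeasE//; last exact: lfm_diff_sum.
by rewrite lmeas_sum; apply: eq_bigr => i Pi; rewrite to_lmeasE//; exact: dF.
Qed.

Lemma to_lmeas_delta0 : to_lmeas (@delta0 R) = 1.
Proof.
by apply: lmeasP => A bA; rewrite to_lmeasE ?mk_lmeasE//; exact: lfm_diff_delta0.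
Qed.

Lemma mxconv_diff (n p r : nat) (A : 'M[set R -> R]_(n, p))
    (B : 'M[set R -> R]_(p, r)) :
  (forall i j, lfm_diff (A i j)) -> (forall i j, lfm_diff (B i j)) ->
  forall i j, lfm_diff (mxconv A B i j).
Proof.
move=> dA dB i j; rewrite mxE; apply: lfm_diff_sum => k _; exact: lfm_diff_mconv.
Qed.

Lemma to_lmeas_mxconv (n p r : nat) (A : 'M[set R -> R]_(n, p))
    (B : 'M[set R -> R]_(p, r)) :
  (forall i j, lfm_diff (A i j)) -> (forall i j, lfm_diff (B i j)) ->
  map_mx to_lmeas (mxconv A B) = map_mx to_lmeas A *m map_mx to_lmeas B.
Proof.
move=> dA dB; apply/matrixP => i j; rewrite !mxE to_lmeas_sum; last first.
  by move=> k _; exact: lfm_diff_mconv.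
by apply: eq_bigr => k _; rewrite !mxE to_lmeas_mconv.
Qed.

Lemma to_lmeas_mxdelta (n : nat) : map_mx to_lmeas (@mxdelta R n) = 1%:M.
Proof.
apply/matrixP => i j; rewrite !mxE; case: eqVneq => _; first exact: to_lmeas_delta0.
by apply: lmeasP => A bA; rewrite to_lmeasE ?lmeas0E//; exact: lfm_diff0.
Qed.

(** The two claims are proved together: [to_lmeas_mconv] applies to the tail of the product only
    once the tail is known to be a difference of positive measures. *)
Lemma to_lmeas_prod I (r : seq I) (F : I -> set R -> R) :
  (forall i, lfm_diff (F i)) ->
  lfm_diff (\big[mconv/@delta0 R]_(i <- r) F i) /\
  to_lmeas (\big[mconv/@delta0 R]_(i <- r) F i) = \prod_(i <- r) to_lmeas (F i).
Proof.
move=> dF; elim: r => [|i r [ihd ih]].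
  by rewrite !big_nil to_lmeas_delta0; split => //; exact: lfm_diff_delta0.
by rewrite !big_cons to_lmeas_mconv// ih; split => //; exact: lfm_diff_mconv.
Qed.

Lemma lfm_diff_sign k mu : lfm_diff mu -> lfm_diff (fun A => (-1) ^+ k * mu A).
Proof.
move=> dmu; elim: k => [|k ih]; first by under eq_fun do rewrite expr0 mul1r.
by under eq_fun do rewrite exprS -mulrA mulN1r; exact: lfm_diffN.
Qed.

Lemma convdet_diff (n : nat) (A : 'M[set R -> R]_n) :
  (forall i j, lfm_diff (A i j)) -> lfm_diff (convdet A).
Proof.
move=> dA; apply: lfm_diff_sum => s _; apply: lfm_diff_sign.
by have [] := to_lmeas_prod (index_enum 'I_n) (fun i => dA i (s i)).
Qed.

(** Identifies the Leibniz sum over [mconv] with the library determinant, which brings in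
    [det_mulmx] and the adjugate. *)
Lemma to_lmeas_convdet (n : nat) (A : 'M[set R -> R]_n) :
  (forall i j, lfm_diff (A i j)) ->
  to_lmeas (convdet A) = \det (map_mx to_lmeas A).
Proof.
move=> dA; have dprod (s : 'S_n) := to_lmeas_prod (index_enum 'I_n) (fun i => dA i (s i)).
rewrite to_lmeas_sum; last by move=> s _; apply: lfm_diff_sign; have [] := dprod s.
apply: eq_bigr => s _; under eq_bigr do rewrite mxE.
have [ds dE] := dprod s; rewrite -dE; apply: lmeasP => B bB.
by rewrite to_lmeasE ?lmeas_signM ?to_lmeasE//; exact: lfm_diff_sign.
Qed.

End LocalMeasureRing.

(** * Measures with a density *)

Section Density.
Context {R : realType}.
Local Notation T := (measurableTypeR R).
Local Notation L := (@lebesgue_measure R).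
Local Open Scope ereal_scope.

(** Lebesgue measure is determined by its values on half-open intervals, whose lengths a shift
    preserves. *)
Lemma lebesgue_measure_translate (t : R) (A : set T) : measurable A ->
  pushforward L (fun x : T => (x - t)%R : T) A = L A.
Proof.
move=> mA.
have mf : measurable_fun setT (fun x : T => (x - t)%R : T) by exact: measurable_funB.
pose mu := measure_function_pushforward__canonical__measure_function_Measure L mf.
apply/esym; apply: (@lebesgue_measure_unique R mu) => //= _ [[a b]] _ <-.
rewrite /pushforward/=.
rewrite [X in _ = lebesgue_measure X](_ : _ = `](a + t)%R, (b + t)%R]%classic).
  rewrite !lebesgue_measure_itv/= !lte_fin ltrD2r; case: ifP => // _.
  by rewrite -!EFinB; congr (_%:E); ring.
by apply/seteqP; split => x /=; rewrite !in_itv/= ltrBrDr lerBlDr.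
Qed.

Lemma ge0_integral_translate (g : T -> \bar R) (t : R) :
  measurable_fun setT g -> (forall x, 0 <= g x) ->
  \int[L]_x g (x - t)%R = \int[L]_x g x.
Proof.
move=> mg g0.
have mf : measurable_fun setT (fun x : T => (x - t)%R : T) by exact: measurable_funB.
transitivity (\int[pushforward L (fun x : T => (x - t)%R : T)]_x g x).
  by rewrite ge0_integral_pushforward.
pose mu := measure_function_pushforward__canonical__measure_function_Measure L mf.
apply: (@eq_measure_integral _ _ _ setT L mu) => A mA _.
exact: lebesgue_measure_translate.
Qed.

Record loc_density (g : T -> \bar R) : Prop := LocDensity {
  loc_density_meas : measurable_fun setT g;
  loc_density_ge0 : forall x, 0 <= g x;
  loc_density_left : exists a, forall x, (x < a)%R -> g x = 0;
  loc_density_lty : forall b, \int[L]_(x in `]-oo, b]) g x < +oo }.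

Section Make.
Variables (g : T -> \bar R) (dg : loc_density g).

Definition density_fun of loc_density g : set T -> \bar R :=
  fun A => \int[L]_(x in A) g x.

Let density0 : density_fun dg set0 = 0.
Proof. exact: integral_set0. Qed.

Let density_ge0 A : 0 <= density_fun dg A.
Proof. by apply: integral_ge0 => x _; exact: loc_density_ge0. Qed.

Let density_sigma_additive : semi_sigma_additive (density_fun dg).
Proof.
exact: semi_sigma_additive_nng_induced (loc_density_meas dg) (loc_density_ge0 dg).
Qed.

HB.instance Definition _ := isMeasure.Build _ _ _ (density_fun dg)
  density0 density_ge0 density_sigma_additive.

Lemma left_finite_density : left_finite (density_fun dg).
Proof.
split; last exact: loc_density_lty.
have [a ga] := loc_density_left dg; exists a; apply: integral0_eq => x /=.
by rewrite in_itv/= => /ga.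
Qed.

Definition density : lfm := mk_lfm left_finite_density.

Lemma densityE A : density A = \int[L]_(x in A) g x. Proof. by []. Qed.

Lemma measurable_density_conv (m : @lfm R) :
  measurable_fun setT (fun x : T => \int[m]_t g (x - t)%R).
Proof.
apply: (@measurable_fun_fubini_tonelli_F _ _ _ _ _ m (fun p : T * T => g (p.1 - p.2)%R)).
  apply: measurableT_comp; first exact: loc_density_meas.
  exact: measurable_funB.
by move=> p; exact: loc_density_ge0.
Qed.

(** A shift of the inner variable by [t] replaces the translate of [A] by [A] itself, which no
    longer depends on [t], and Tonelli's theorem exchanges the integrals. Taken with density
    [|f|^q], this is the last step of Young's inequality. *)
Lemma lfm_conv_density (m : @lfm R) (A : set T) : measurable A ->
  lfm_conv m density A = \int[L]_(x in A) \int[m]_t g (x - t)%R.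
Proof.
move=> mA; rewrite lfm_convE.
pose phi (p : T * T) := (g \o (fun p : T * T => (p.2 - p.1)%R : T)) \_ (setT `*` A) p.
have mphi : measurable_fun setT phi.
  apply/(measurable_restrictT _ _).1; first exact: measurableX.
  apply: measurable_funTS; apply: measurableT_comp; first exact: loc_density_meas.
  exact: measurable_funB.
have phi0 p : 0 <= phi p.
  by rewrite /phi patchE; case: ifP => // _; exact: loc_density_ge0.
transitivity (\int[m]_t \int[L]_x phi (t, x)).
  apply: eq_integral => t _; rewrite densityE.
  have mAt := measurable_translate t mA.
  rewrite integral_mkcond -[LHS](@ge0_integral_translate _ t).
  - apply: eq_integral => x _; rewrite /phi !patchE.
    rewrite [X in _ = if X then _ else _](_ : _ = (x \in A)); last first.
      by apply/idP/idP; rewrite !inE/=; [case|split].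
    rewrite [X in if X then _ else _](_ : _ = (x \in A))//.
    by apply/idP/idP; rewrite !inE; [case=> y Ay /addIr <-|exists x].
  - apply/(measurable_restrictT _ _).1 => //; apply: measurable_funTS.
    exact: loc_density_meas.
  - by move=> x; rewrite patchE; case: ifP => // _; exact: loc_density_ge0.
rewrite (@fubini_tonelli _ _ _ _ _ m L phi)//= [RHS]integral_mkcond.
apply: eq_integral => x _; rewrite patchE; case: ifPn => xA.
  apply: eq_integral => t _; rewrite /phi patchE ifT// inE/=; split => //.
  by move: xA; rewrite inE.
apply: integral0_eq => t _; rewrite /phi patchE ifF//; apply/negP; rewrite inE/= => -[_].
by move=> Ax; move: xA; rewrite notin_setE.
Qed.

End Make.
End Density.

(** * Locally [L^q] functions *)

Section LocalLq.
Context {R : realType}.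
Local Notation T := (measurableTypeR R).
Local Notation L := (@lebesgue_measure R).
Implicit Types (q : R) (f g : R -> R) (m : @lfm R) (A : set R).
Local Open Scope ereal_scope.

(** Contains the inputs and also their convolutions with the entries of [Q^-1], which may extend
    indefinitely to the right. *)
Definition loc_Lq q f := [/\ measurable_fun setT f,
  exists a, forall x, (x < a)%R -> f x = 0%R &
  forall b, \int[L]_(x in `]-oo, b]) (`|f x| `^ q)%:E < +oo].

Lemma measurable_powR_norm q f (D : set R) : measurable_fun D f ->
  measurable_fun D (fun x => (`|f x| `^ q)%:E).
Proof.
move=> mf; apply/measurable_EFinP.
by apply: (measurableT_comp (measurable_powR q)); exact: measurableT_comp.
Qed.

Lemma loc_Lq_density q f : (1 <= q)%R -> loc_Lq q f ->
  loc_density (fun x => (`|f x| `^ q)%:E).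
Proof.
move=> q1 [mf [a fa] fq]; split => //.
- exact: measurable_powR_norm.
- exists a => x xa; rewrite fa// normr0 powR0// gt_eqF// (lt_le_trans ltr01)//.
Qed.

Lemma loc_Lq_dominated q f g : (1 <= q)%R -> measurable_fun setT f -> loc_Lq q g ->
  (forall x, `|f x| <= `|g x|)%R -> loc_Lq q f.
Proof.
move=> q1 mf [mg [a ga] gq] fg; split; first exact: mf.
  exists a => x /ga gx; apply/eqP; rewrite -normr_le0.
  by have := fg x; rewrite gx normr0.
move=> b; apply: le_lt_trans (gq b); apply: ge0_le_integral => //.
- by apply: measurable_powR_norm; exact: measurable_funTS.
- by apply: measurable_powR_norm; exact: measurable_funTS.
- by move=> x _; rewrite lee_fin ge0_ler_powR ?nnegrE// (le_trans ler01).
Qed.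

Lemma loc_Lq_patch q f (B : set R) : (1 <= q)%R -> measurable B -> loc_Lq q f ->
  loc_Lq q (f \_ B).
Proof.
move=> q1 mB fq; apply: (loc_Lq_dominated q1 _ fq) => [|x].
  apply/(measurable_restrictT _ _).1 => //; apply: measurable_funTS; by case: fq.
by rewrite patchE; case: ifP; rewrite ?normr0.
Qed.

Lemma loc_LqD q f g : (1 <= q)%R -> loc_Lq q f -> loc_Lq q g ->
  loc_Lq q (f \+ g)%R.
Proof.
move=> q1 [mf [a fa] fq] [mg [c gc] gq]; split.
- exact: measurable_funD.
- exists (Num.min a c) => x; rewrite lt_min => /andP[xa xc].
  by rewrite /= fa// gc// addr0.
(* The constant comes from [|f + g| <= 2 max(|f|, |g|)], raised to the power [q]. *)
- move=> b; pose k := (2 `^ q)%R.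
  have k0 : (0 <= k)%R by exact: powR_ge0.
  have pf : measurable_fun `]-oo, b]%classic (fun x => (`|f x| `^ q)%:E).
    by apply: measurable_powR_norm; exact: measurable_funTS.
  have pg : measurable_fun `]-oo, b]%classic (fun x => (`|g x| `^ q)%:E).
    by apply: measurable_powR_norm; exact: measurable_funTS.
  apply: (@le_lt_trans _ _ (\int[L]_(x in `]-oo, b])
      (k%:E * ((`|f x| `^ q)%:E + (`|g x| `^ q)%:E)))).
    apply: ge0_le_integral => //.
    + apply: measurable_powR_norm; apply: measurable_funTS; exact: measurable_funD.
    + by apply: measurable_funeM; exact: emeasurable_funD.
    + move=> x _; rewrite -EFinD -EFinM lee_fin.
      wlog fg : f g {fa gc fq gq mf mg pf pg} / (`|f x| <= `|g x|)%R.
        move=> wl; case/orP: (le_total `|f x|%R `|g x|%R) => [fg|gf].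
          exact: (wl f g fg).
        by have := wl g f gf; rewrite /= addrC [X in (_ <= k * X)%R]addrC.
      apply: (@le_trans _ _ ((2 * `|g x|) `^ q)%R).
        rewrite ge0_ler_powR ?nnegrE ?mulr_ge0// ?(le_trans ler01)//.
        by rewrite (le_trans (ler_normD _ _))//; lra.
      by rewrite powRM// ler_wpM2l// lerDr powR_ge0.
  rewrite ge0_integralZl_EFin//; last 2 first.
    by move=> x _; rewrite adde_ge0// lee_fin powR_ge0.
    exact: emeasurable_funD.
  rewrite ge0_integralD//; [|by move=> x _; rewrite lee_fin powR_ge0..].
  by rewrite lte_mul_pinfty// lte_add_pinfty.
Qed.

Lemma loc_LqN q f : loc_Lq q f -> loc_Lq q (fun x => - f x)%R.
Proof.
move=> [mf [a fa] fq]; split; first exact: measurableT_comp.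
  by exists a => x /fa ->; rewrite oppr0.
by move=> b; under eq_integral do rewrite normrN; exact: fq.
Qed.

Lemma loc_LqB q f g : (1 <= q)%R -> loc_Lq q f -> loc_Lq q g ->
  loc_Lq q (fun x => f x - g x)%R.
Proof. by move=> q1 fq gq; exact: (loc_LqD q1 fq (loc_LqN gq)). Qed.

Lemma loc_Lq0 q : (1 <= q)%R -> loc_Lq q (cst 0%R).
Proof.
move=> q1; split; [exact: measurable_cst|by exists 0%R|].
move=> b; rewrite integral0_eq ?ltry// => x _.
by rewrite normr0 powR0// gt_eqF// (lt_le_trans ltr01).
Qed.

Lemma loc_Lq_sum q (I : Type) (r : seq I) (F : I -> R -> R) : (1 <= q)%R ->
  (forall i, loc_Lq q (F i)) -> loc_Lq q (fun x => \sum_(i <- r) F i x)%R.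
Proof.
move=> q1 Fq; elim: r => [|i r ih].
  by under eq_fun do rewrite big_nil; exact: loc_Lq0.
by under eq_fun do rewrite big_cons; exact: (loc_LqD q1 (Fq i) ih).
Qed.

Lemma loc_Lq1 q f : (1 <= q)%R -> loc_Lq q f -> loc_Lq 1 f.
Proof.
move=> q1 [mf [a fa] fq]; split; [exact: mf|by exists a|].
move=> b; have pf : measurable_fun `]-oo, b]%classic (fun x => (`|f x| `^ q)%:E).
  by apply: measurable_powR_norm; exact: measurable_funTS.
have mab : measurable_fun `]-oo, b]%classic (EFin \o \1_`[a, b]%classic : R -> \bar R).
  by apply/measurable_EFinP; exact: measurable_funTS.
(* Pointwise, [|f|] is at most 1 or at most [|f|^q], and the constant 1 is only needed on [[a, b]]
   since [f] vanishes before [a]. *)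
apply: (@le_lt_trans _ _ (\int[L]_(x in `]-oo, b])
    ((\1_`[a, b]%classic x)%:E + (`|f x| `^ q)%:E))).
  apply: ge0_le_integral => //.
  - by apply: measurable_powR_norm; exact: measurable_funTS.
  - exact: emeasurable_funD.
  - move=> x; rewrite /= in_itv/= => xb; rewrite -EFinD lee_fin powRr1//.
    have [xa|xa] := ltP x a.
      by rewrite fa// normr0 addr_ge0// powR_ge0.
    rewrite indicE mem_set/= ?in_itv/= ?xa//=.
    have [f1|f1] := lerP `|f x| 1; first by rewrite (le_trans f1)// lerDl powR_ge0.
    rewrite (@le_trans _ _ (`|f x| `^ q)%R)// ?lerDr//.
    by rewrite -[leLHS]powRr1// ler_powR// ltW.
rewrite ge0_integralD//.
rewrite lte_add_pinfty// integral_indic//.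
apply: (@le_lt_trans _ _ (L `[a, b]%classic)).
  by apply: le_measure; rewrite ?inE//; exact: measurableI.
rewrite lebesgue_measure_itv/=; case: ifP => _; rewrite -?EFinB ?ltry//.
Qed.

Section Hoelder.

(* Hoelder's inequality against the indicator of [W], raised to the power q. *)
Lemma hoelder_indic m q (W : set T) : (1 <= q)%R -> measurable W -> m W < +oo ->
  exists2 K : R, (0 <= K)%R & forall h : T -> R, measurable_fun setT h ->
    (forall t, ~ W t -> h t = 0%R) ->
    (\int[m]_t `|h t|%:E) `^ q <= K%:E * \int[m]_t (`|h t| `^ q)%:E.
Proof.
(* For [q = 1] the conjugate exponent is infinite; the inequality is then an equality with constant
   1. *)
rewrite le_eqVlt => /orP[/eqP <- _ _|q1 mW mWoo].
  exists 1%R => // h mh h0; rewrite mul1e poweRe1; last exact: integral_ge0.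
  by rewrite le_eqVlt; apply/orP; left; apply/eqP; apply: eq_integral => t _;
    rewrite powRr1.
have q0 : (0 < q)%R by rewrite (lt_trans ltr01).
pose p := (q / (q - 1))%R.
have p0 : (0 < p)%R by rewrite divr_gt0// subr_gt0.
have pq : (q^-1 + p^-1 = 1)%R.
  by rewrite /p invf_div -[X in (X + _)%R]mul1r -mulrDl addrC subrK divff// gt_eqF.
have Np : 'N[m]_p%:E[EFin \o \1_W] < +oo.
  rewrite unlock; apply: poweR_lty.
  rewrite (eq_integral (fun t => (\1_W t)%:E)); last first.
    move=> t _; rewrite /= indicE; case: (t \in W) => /=.
      by rewrite normr1 powR1.
    by rewrite normr0 powR0// gt_eqF.
  by rewrite integral_indic// setIT.
(* This is [m W] to the power [q - 1]. *)
pose K := 'N[m]_p%:E[EFin \o \1_W] `^ q.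
have Kfin : K \is a fin_num.
  by rewrite ge0_fin_numE ?poweR_ge0//; exact: poweR_lty.
exists (fine K) => [|h mh h0]; first by rewrite fine_ge0// poweR_ge0.
have := @hoelder _ _ _ m h \1_W q p mh _ q0 p0 pq.
have -> : 'N[m]_1[EFin \o (h \* \1_W)%R] = \int[m]_t `|h t|%:E.
  rewrite Lnorm1; apply: eq_integral => t _ /=; rewrite indicE.
  have [Wt|Wt] := boolP (t \in W); first by rewrite mulr1.
  by rewrite mulr0 h0 ?normr0//; move: Wt; rewrite notin_setE.
move=> /(_ (measurable_indic mW)) hh; rewrite fineK// muleC.
have -> : \int[m]_t (`|h t| `^ q)%:E = 'N[m]_q%:E[EFin \o h] `^ q.
  by rewrite powR_Lnorm ?gt_eqF.
rewrite /K -poweRM ?Lnorm_ge0//; apply: gt0_ler_poweR => //.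
- exact: ltW.
- by rewrite in_itv/= leey andbT integral_ge0.
- by rewrite in_itv/= leey andbT mule_ge0// Lnorm_ge0.
Qed.

End Hoelder.
End LocalLq.

(** * Convolution of a positive measure with a function *)

Section ConvolutionFunction.
Context {R : realType}.
Local Notation T := (measurableTypeR R).
Local Notation L := (@lebesgue_measure R).
Implicit Types (q : R) (f g : R -> R) (m : @lfm R) (A : set R).
Local Open Scope ereal_scope.

Lemma measurable_fun_reflect d (S : measurableType d) (f : T -> S) (x : R) :
  measurable_fun setT f -> measurable_fun setT (fun t : T => f (x - t)%R).
Proof.
move=> mf; apply: (measurableT_comp mf).
by apply: measurable_funB => //; exact: measurable_cst.
Qed.

Lemma measurable_integral_reflect m (f : T -> \bar R) :
  measurable_fun setT f -> (forall x, 0 <= f x) ->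
  measurable_fun setT (fun x : T => \int[m]_t f (x - t)%R).
Proof.
move=> mf f0.
apply: (@measurable_fun_fubini_tonelli_F _ _ _ _ _ m
  (fun p : T * T => f (p.1 - p.2)%R)) => //.
by apply: (measurableT_comp mf); exact: measurable_funB.
Qed.

(** Where the integral is not finite, [fine] returns 0; for locally integrable [f] vanishing far to
    the left, such points are negligible. *)
Definition lfm_convf m f : R -> R := fun x => fine (\int[m]_t (f (x - t)%R)%:E).

Lemma measurable_lfm_convf m f : measurable_fun setT f ->
  measurable_fun setT (lfm_convf m f).
Proof.
move=> mf; apply: measurableT_comp => //.
have mf' : measurable_fun setT (EFin \o f) by exact/measurable_EFinP.
rewrite (_ : (fun x => _) = fun x : T => \int[m]_t (EFin \o f)^\+ (x - t)%R -
  \int[m]_t (EFin \o f)^\- (x - t)%R); last first.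
  apply/funext => x; rewrite integralE. 
  by congr (_ - _); apply: eq_integral => t _; rewrite ?funeposE ?funenegE.
apply: emeasurable_funB.
  apply: measurable_integral_reflect; first exact: measurable_funepos.
  by move=> x; exact: funepos_ge0.
apply: measurable_integral_reflect; first exact: measurable_funeneg.
by move=> x; exact: funeneg_ge0.
Qed.

(** A local Young inequality: Hoelder's inequality in [t] with a constant uniform in [x <= b], then
    integration in [x], where [lfm_conv_density] recognizes the convolution of [m] with the measure
    of density [|f|^q]. *)
Lemma loc_Lq_lfm_convf q m f : (1 <= q)%R -> loc_Lq q f ->
  loc_Lq q (lfm_convf m f).
Proof.
move=> q1 fq; have dfq := loc_Lq_density q1 fq; have [mf [a fa] _] := fq.
have mfE x : measurable_fun setT (fun t : T => (f (x - t)%R)%:E).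
  by apply/measurable_EFinP; exact: measurable_fun_reflect.
split; first exact: measurable_lfm_convf.
  (* For [x < c + a], a point [t] either is below [c], where [m] is null, or satisfies [x - t < a],
     where [f] vanishes. *)
  have [[c mc] _] := lfmP m; exists (c + a)%R => x xca.
  rewrite /lfm_convf (_ : \int[m]_t _ = 0)//.
  rewrite -[RHS](@null_set_integral _ _ _ m `]-oo, c[%classic
    (fun t => (f (x - t)%R)%:E))//.
    rewrite [RHS]integral_mkcond; apply: eq_integral => t _; rewrite patchE.
    case: ifPn => //; rewrite notin_setE/= in_itv/= => /negP; rewrite -leNgt => ct.
    by rewrite fa//; lra.
  exact: measurable_funTS.
(* When [x <= b], the integrand [f (x - t)] vanishes for [t > b - a], so only a set of finite
   [m]-measure contributes, the same for all these [x]. *)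
move=> b; have mW : m `]-oo, (b - a)%R]%classic < +oo by exact: (lfmP m).2.
have [K K0 hK] := @hoelder_indic R m q `]-oo, (b - a)%R]%classic q1 (measurable_itv _) mW.
have mG := measurable_density_conv dfq m.
apply: (@le_lt_trans _ _ (\int[L]_(x in `]-oo, b]%classic)
    (K%:E * \int[m]_t (`|f (x - t)%R| `^ q)%:E))).
  apply: ge0_le_integral => //.
  - apply: measurable_powR_norm; apply: measurable_funTS; exact: measurable_lfm_convf.
  - by apply: measurable_funeM; exact: measurable_funTS.
  - move=> x; rewrite /= in_itv/= => xb; apply: le_trans (hK (fun t => f (x - t)%R) _ _).
    + rewrite -poweR_EFin; apply: gt0_ler_poweR; first by rewrite (le_trans ler01).
        by rewrite in_itv/= leey andbT lee_fin.
        by rewrite in_itv/= leey andbT integral_ge0.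
      apply: (@le_trans _ _ `|\int[m]_t (f (x - t)%R)%:E|).
        by rewrite /lfm_convf; case: (\int[m]_t _) => //=; rewrite ?normr0 ?leey.
      exact: le_abse_integral.
    + exact: measurable_fun_reflect.
    + move=> t; rewrite /= in_itv/= => /negP; rewrite -ltNge => tb.
      by rewrite fa//; lra.
rewrite ge0_integralZl_EFin//; last 2 first.
  by move=> x _; apply: integral_ge0 => t _; rewrite lee_fin powR_ge0.
  exact: measurable_funTS.
rewrite lte_mul_pinfty// -(lfm_conv_density dfq)//; exact: (lfmP _).2.
Qed.

Lemma integrable_loc_Lq f A : loc_Lq 1 f -> bounded_borel A ->
  L.-integrable A (EFin \o f).
Proof.
move=> [mf _ fq] /bounded_borelP[mA [b Ab]]; apply/integrableP; split.
  by apply/measurable_EFinP; exact: measurable_funTS.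
apply: le_lt_trans (fq b).
under [leRHS]eq_integral do rewrite powRr1//.
apply: ge0_subset_integral => //.
- by apply/measurable_EFinP; apply: measurableT_comp => //; exact: measurable_funTS.
- by move=> x /Ab/=; rewrite !in_itv/= => /andP[].
Qed.

Section PosNeg.
Variables (f : R -> R) (f1 : loc_Lq 1 f).

Let loc_density_part (g : T -> \bar R) : measurable_fun setT g ->
  (forall x, 0 <= g x) -> (forall x, g x <= `|f x|%:E) -> loc_density g.
Proof.
move=> mg g0 gf; have [mf [a fa] fq] := f1; split => //.
  exists a => x /fa fx; apply/eqP; rewrite eq_le g0 andbT.
  by rewrite (le_trans (gf x))// fx normr0.
move=> b; apply: le_lt_trans (fq b); under [leRHS]eq_integral do rewrite powRr1//.
apply: ge0_le_integral => //.
- exact: measurable_funTS.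
- by apply/measurable_EFinP; apply: measurableT_comp => //; exact: measurable_funTS.
Qed.

Let mf : measurable_fun setT (EFin \o f : T -> \bar R).
Proof. by case: f1 => mf _ _; exact/measurable_EFinP. Qed.

Lemma loc_density_pos : loc_density ((EFin \o f)^\+ : T -> \bar R).
Proof.
apply: loc_density_part => // [|x]; first exact: measurable_funepos.
by rewrite funeposE /= ge_max !lee_fin normr_ge0 ler_norm.
Qed.

Lemma loc_density_neg : loc_density ((EFin \o f)^\- : T -> \bar R).
Proof.
apply: loc_density_part => // [|x]; first exact: measurable_funeneg.
by rewrite funenegE /= ge_max !lee_fin normr_ge0 -normrN ler_norm.
Qed.

Definition pos_lfm := density loc_density_pos.
Definition neg_lfm := density loc_density_neg.

End PosNeg.

Definition fint f : set R -> R := fun A => fine (\int[L]_(x in A) (f x)%:E).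

Lemma fint_repr f (f1 : loc_Lq 1 f) : lfm_repr (fint f) (pos_lfm f1) (neg_lfm f1).
Proof.
move=> A bA; rewrite /fint integralE fineB//.
- exact: (lfm_fin (pos_lfm f1)).
- exact: (lfm_fin (neg_lfm f1)).
Qed.

Lemma fintB f g A : loc_Lq 1 f -> loc_Lq 1 g -> bounded_borel A ->
  fint (fun x => f x - g x)%R A = (fint f A - fint g A)%R.
Proof.
move=> f1 g1 bA; rewrite /fint.
have fA := integrable_loc_Lq f1 bA; have gA := integrable_loc_Lq g1 bA.
have -> : \int[L]_(x in A) (f x - g x)%:E =
    \int[L]_(x in A) (f x)%:E - \int[L]_(x in A) (g x)%:E.
  by rewrite -integralB_EFin//; exact: bA.1.
by rewrite fineB//; apply: integrable_fin_num => //; exact: bA.1.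
Qed.

(** The convolutions [F] and [G] of the positive and negative parts of [f] have finite integrals
    over the bounded set [A], hence are finite almost everywhere there; at these points the [fine]
    in [lfm_convf] loses nothing and the integral is [F - G]. *)
Lemma fint_lfm_convf m f (f1 : loc_Lq 1 f) A : bounded_borel A ->
  fint (lfm_convf m f) A =
  (fine (lfm_conv m (pos_lfm f1) A) - fine (lfm_conv m (neg_lfm f1) A))%R.
Proof.
move=> bA; have mA : measurable (A : set T) := bA.1; rewrite /fint.
pose F x := \int[m]_t (EFin \o f)^\+ (x - t)%R.
pose G x := \int[m]_t (EFin \o f)^\- (x - t)%R.
have FE : \int[L]_(x in A) F x = lfm_conv m (pos_lfm f1) A by rewrite lfm_conv_density.
have GE : \int[L]_(x in A) G x = lfm_conv m (neg_lfm f1) A by rewrite lfm_conv_density.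
have F0 x : 0 <= F x by exact: integral_ge0.
have G0 x : 0 <= G x by exact: integral_ge0.
have mF : measurable_fun A F.
  by apply: measurable_funTS; exact: measurable_density_conv (loc_density_pos f1) m.
have mG : measurable_fun A G.
  by apply: measurable_funTS; exact: measurable_density_conv (loc_density_neg f1) m.
have intF : L.-integrable A F.
  apply/integrableP; split => //; under eq_integral do rewrite gee0_abs//.
  by rewrite FE ltey_eq lfm_fin.
have intG : L.-integrable A G.
  apply/integrableP; split => //; under eq_integral do rewrite gee0_abs//.
  by rewrite GE ltey_eq lfm_fin.
have [mf _ _] := f1.
rewrite (@ae_eq_integral _ _ _ L A (fun x => F x - G x))//.
- by rewrite integralB// fineB ?FE ?GE// lfm_fin.
- by apply/measurable_EFinP; apply: measurable_funTS; exact: measurable_lfm_convf.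
- exact: emeasurable_funB.
- have aeF := integrable_ae mA intF; have aeG := integrable_ae mA intG.
  apply: filterS2 aeF aeG => x Fx Gx Ax.
  rewrite /lfm_convf; have -> : \int[m]_t (f (x - t)%R)%:E = F x - G x.
    rewrite integralE; congr (_ - _); apply: eq_integral => t _;
      by rewrite ?funeposE ?funenegE.
  by rewrite fineK// fin_numB Fx// Gx.
Qed.

End ConvolutionFunction.

(** * Functions as elements of the ring *)

Section FunctionsAsMeasures.
Context {R : realType}.
Local Notation T := (measurableTypeR R).
Local Notation L := (@lebesgue_measure R).
Implicit Types (q : R) (f g : R -> R) (mu : set R -> R) (A : set R).

Lemma fint_diff f : loc_Lq 1 f -> lfm_diff (fint f).
Proof. by move=> f1; exists (pos_lfm f1), (neg_lfm f1); exact: fint_repr. Qed.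

Definition fmeas f : @lmeas R := to_lmeas (fint f).

Lemma fmeasE f A : loc_Lq 1 f -> bounded_borel A -> fmeas f A = fint f A.
Proof. by move=> f1 bA; rewrite (to_lmeasE (fint_diff f1) bA). Qed.

Lemma fmeasB f g : loc_Lq 1 f -> loc_Lq 1 g ->
  fmeas (fun x => f x - g x) = fmeas f - fmeas g.
Proof.
move=> f1 g1; apply: lmeasP => A bA.
rewrite lmeasD lmeasN (fmeasE (loc_LqB (lexx 1) f1 g1) bA).
by rewrite (fmeasE f1 bA) (fmeasE g1 bA); exact: fintB.
Qed.

Lemma fmeas_patch f (B A : set R) : measurable B -> loc_Lq 1 f -> bounded_borel A ->
  fmeas (f \_ B) A = fmeas f (A `&` B).
Proof.
move=> mB f1 bA; have bAB : bounded_borel (A `&` B).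
  by apply: (bounded_borelS _ _ bA); [exact: measurableI bA.1 mB|exact: subIsetl].
rewrite (fmeasE (loc_Lq_patch (lexx 1) mB f1) bA) (fmeasE f1 bAB).
by rewrite /fint [in RHS]integral_mkcondr; congr fine; apply: eq_integral => x _;
  rewrite !patchE; case: ifP.
Qed.

(** The way back from the ring to functions. Equality of integrals gives equality almost everywhere
    on each bounded piece [D_ n], and countably many negligible sets are discarded. *)
Lemma fint_ae_eq f g (D : set R) : loc_Lq 1 f -> loc_Lq 1 g -> measurable D ->
  (forall A, bounded_borel A -> A `<=` D -> fmeas f A = fmeas g A) ->
  ae_eq L D f g.
Proof.
move=> f1 g1 mD fg; pose D_ n := D `&` `[- n%:R, n%:R].
have bD n : bounded_borel (D_ n).
  apply: (bounded_borelS _ _ (bounded_borel_itvcc (- n%:R) n%:R)); last exact: subIsetr.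
  exact: measurableI.
have fgn n : ae_eq L (D_ n) (EFin \o f) (EFin \o g).
  apply: integral_ae_eq; [exact: (bD n).1|exact: integrable_loc_Lq f1 (bD n)| |].
    by case: g1 => mg _ _; apply/measurable_EFinP; exact: measurable_funTS.
  move=> E ED mE; have bE : bounded_borel E by exact: (bounded_borelS mE ED (bD n)).
  have fin h : loc_Lq 1 h -> (\int[L]_(x in E) (EFin \o h) x)%E \is a fin_num.
    by move=> h1; apply: integrable_fin_num => //; exact: integrable_loc_Lq h1 bE.
  rewrite -[LHS](fineK (fin _ f1)) -[RHS](fineK (fin _ g1)); congr (_%:E).
  have := fg E bE (subset_trans ED (@subIsetl _ _ _)).
  by rewrite (fmeasE f1 bE) (fmeasE g1 bE).
have : L.-negligible (\bigcup_n ~` [set x | D_ n x -> (EFin \o f) x = (EFin \o g) x]).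
  by apply: negligible_bigcup => n; exact: fgn.
apply: negligibleS => x /= /not_implyP[Dx fgx].
exists (Num.truncn `|x|).+1 => //=; apply/not_implyP; split; last by move=> [].
split => //=; by rewrite in_itv/= -ler_norml ltW// truncnS_gt.
Qed.

(** The Jordan pair is chosen, so that the formula holds at every point and for every [f], whether
    or not the integrals converge. *)
Lemma convf_lfm_convf mu : lfm_diff mu -> exists m n, lfm_repr mu m n /\
  forall f, convf mu f = fun x => lfm_convf m f x - lfm_convf n f x.
Proof.
move=> /lfm_diff_upvar[m [n [mumn mE nE]]]; exists m, n; split => // f.
by apply/funext => x; rewrite /convf /integral_against -mE -nE.
Qed.

Lemma loc_Lq_convf q mu f : 1 <= q -> lfm_diff mu -> loc_Lq q f ->
  loc_Lq q (convf mu f).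
Proof.
move=> q1 /convf_lfm_convf[m [n [_ ->]]] fq.
exact: (loc_LqB q1 (loc_Lq_lfm_convf m q1 fq) (loc_Lq_lfm_convf n q1 fq)).
Qed.

Lemma fmeas_convf mu f : lfm_diff mu -> loc_Lq 1 f ->
  fmeas (convf mu f) = to_lmeas mu * fmeas f.
Proof.
move=> dmu f1; have [m [n [mumn ->]]] := convf_lfm_convf dmu.
have mf1 := loc_Lq_lfm_convf m (lexx 1) f1.
have nf1 := loc_Lq_lfm_convf n (lexx 1) f1.
rewrite (fmeasB mf1 nf1); apply: lmeasP => A bA.
rewrite lmeasD lmeasN (fmeasE mf1 bA) (fmeasE nf1 bA) !(fint_lfm_convf _ f1 bA).
rewrite (lmeas_mul_repr (to_lmeas_repr mumn) (to_lmeas_repr (fint_repr f1)) bA).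
rewrite !fine_lfm_add//; ring.
Qed.

End FunctionsAsMeasures.

(** * Supports of products and anticausal elements *)

Section Vanishing.
Context {R : realType}.
Implicit Types (x y : @lmeas R) (A B C : set R) (mu : set R -> R).

Definition vanishes_on mu B := forall A, bounded_borel A -> A `<=` B -> mu A = 0.

(** The Jordan pair is essential: the members of another pair could charge [B] and cancel there. *)
Lemma vanishes_on_repr x B : measurable B -> vanishes_on x B ->
  exists m n : @lfm R, [/\ lfm_repr x m n, m B = 0%E & n B = 0%E].
Proof.
move=> mB xB; have [m [n [xmn mE nE]]] := lfm_diff_upvar (lmeas_diff x).
exists m, n; split => //; apply/eqP; rewrite eq_le measure_ge0 andbT.
  by rewrite mE; apply: upvar_le => A bA AB; rewrite xB.
by rewrite nE; apply: upvar_le => A bA AB; rewrite xB// oppr0.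
Qed.

(** For [t] outside of the [m]-null set [A], the translate of [C] by [t] lies in the [n]-null set
    [B], so the integrand vanishes almost everywhere. *)
Lemma lfm_conv_null (m n : @lfm R) A B C :
  measurable A -> measurable B -> measurable C -> m A = 0%E -> n B = 0%E ->
  (forall s t, C (s + t) -> A s \/ B t) -> lfm_conv m n C = 0%E.
Proof.
move=> mA mB mC mA0 nB0 CAB; rewrite lfm_convE.
rewrite (ae_eq_integral (cst 0%E))//=; first by rewrite integral0.
  exact: measurable_fun_translate.
exists A; split => // t /= /not_implyP[_]; apply: contra_notP => At.
apply/eqP; rewrite eq_le measure_ge0 andbT -nB0; apply: le_measure; rewrite ?inE//.
  exact: measurable_translate.
move=> _ [s Cs <-]; have : C (t + (s - t)) by rewrite addrC subrK.
by move=> /CAB[].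
Qed.

(** Support of a product inside the sum of supports, in complementary form. It yields both the
    stability of anticausal elements and the left bound [l] of the truncated input. *)
Lemma vanishes_onM x y A B C : measurable A -> measurable B ->
  vanishes_on x A -> vanishes_on y B ->
  (forall s t, C (s + t) -> A s \/ B t) -> vanishes_on (x * y) C.
Proof.
move=> mA mB xA yB CAB D bD DC.
have [x1 [x2 [xE x1A x2A]]] := vanishes_on_repr mA xA.
have [y1 [y2 [yE y1B y2B]]] := vanishes_on_repr mB yB.
have DAB s t : D (s + t) -> A s \/ B t by move=> /DC; exact: CAB.
rewrite (lmeas_mul_repr xE yE bD) !fine_lfm_add//.
by rewrite !(@lfm_conv_null _ _ A B D) ?bD.1//; [rewrite !addr0 subrr|exact: bD.1..].
Qed.

Lemma vanishes_onD x y B : vanishes_on x B -> vanishes_on y B -> vanishes_on (x + y) B.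
Proof. by move=> xB yB A bA AB; rewrite lmeasD xB// yB// addr0. Qed.

Lemma vanishes_onN x B : vanishes_on x B -> vanishes_on (- x) B.
Proof. by move=> xB A bA AB; rewrite lmeasN xB// oppr0. Qed.

Lemma vanishes_on_sum I (r : seq I) (P : pred I) (F : I -> @lmeas R) B :
  (forall i, P i -> vanishes_on (F i) B) -> vanishes_on (\sum_(i <- r | P i) F i) B.
Proof. by move=> FB A bA AB; rewrite lmeas_sum big1// => i Pi; rewrite FB. Qed.

Definition anticausal x := vanishes_on x `]0, +oo[.

Lemma anticausalM x y : anticausal x -> anticausal y -> anticausal (x * y).
Proof.
move=> x0 y0; apply: (vanishes_onM _ _ x0 y0) => // s t.
rewrite /= !in_itv/= !andbT => st; have [s0|s0] := ltP 0 s; [by left|right]; lra.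
Qed.

Lemma anticausal_sign k x : anticausal x -> anticausal ((-1) ^+ k * x).
Proof. by move=> x0 A bA A0; rewrite lmeas_signM x0// mulr0. Qed.

Lemma anticausal1 : anticausal 1.
Proof.
move=> A bA A0; rewrite mk_lmeasE// /delta0 diracE memNset// => /A0 /=.
by rewrite in_itv/= ltxx.
Qed.

Lemma anticausal_det n (M : 'M[@lmeas R]_n) : (forall i j, anticausal (M i j)) ->
  anticausal (\det M).
Proof.
move=> M0; apply: vanishes_on_sum => s _; apply: anticausal_sign.
apply: big_ind => //; [exact: anticausal1|exact: anticausalM].
Qed.

Lemma anticausal_adj n (M : 'M[@lmeas R]_n) : (forall i j, anticausal (M i j)) ->
  forall i j, anticausal ((\adj M)%R i j).
Proof.
move=> M0 i j; rewrite mxE; apply: anticausal_sign; apply: anticausal_det => k l.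
by rewrite !mxE.
Qed.

Lemma anticausal_mulmx n p r (M : 'M[@lmeas R]_(n, p)) (N : 'M[@lmeas R]_(p, r)) :
  (forall i j, anticausal (M i j)) -> (forall i j, anticausal (N i j)) ->
  forall i j, anticausal ((M *m N) i j).
Proof.
by move=> M0 N0 i j; rewrite mxE; apply: vanishes_on_sum => k _; exact: anticausalM.
Qed.

Lemma vanishes_on_supp mu B : lfm_diff mu -> B `&` supp mu = set0 -> vanishes_on mu B.
Proof.
move=> [m [n mumn]] Bmu A bA AB.
apply: (loc_sigma_additive_supp (lfm_repr_additive mumn) bA).
by apply/seteqP; split => // x [/AB Bx sx]; rewrite -Bmu.
Qed.

End Vanishing.

(** * Infimum of the support, and passage between functions and ring elements *)

Section Elements.
Context {R : realType}.
Local Notation L := (@lebesgue_measure R).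
Implicit Types (f g : R -> R) (mu : set R -> R) (A B : set R).

Lemma to_lmeas_id (x : @lmeas R) : to_lmeas x = x.
Proof. by apply: lmeasP => A bA; rewrite (to_lmeasE (lmeas_diff x) bA). Qed.

Lemma lmeas_set0 (x : @lmeas R) : x set0 = 0.
Proof. by have [m [n xmn]] := lmeas_diff x; exact: (lfm_repr_additive xmn).1. Qed.

Lemma lmeas_setID (x : @lmeas R) A B : bounded_borel A -> measurable B ->
  x A = x (A `&` B) + x (A `\` B).
Proof.
move=> bA mB; have [m [n xmn]] := lmeas_diff x.
rewrite -(loc_additive (lfm_repr_additive xmn)).
- by rewrite setUIDK.
- by apply: (bounded_borelS _ _ bA); [exact: measurableI bA.1 mB|exact: subIsetl].
- by apply: (bounded_borelS _ _ bA); [exact: measurableD bA.1 mB|exact: subDsetl].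
- by rewrite setDE setIACA setICr setI0.
Qed.

Lemma fmeasD f g : loc_Lq 1 f -> loc_Lq 1 g -> fmeas (f \+ g) = fmeas f + fmeas g.
Proof.
move=> f1 g1; have fg1 := loc_LqD (lexx 1) f1 g1.
have := fmeasB fg1 g1; rewrite (_ : (fun x => _) = f); last first.
  by apply/funext => x /=; rewrite addrK.
by move=> ->; rewrite subrK.
Qed.

Lemma fmeas_sum I (r : seq I) (F : I -> R -> R) : (forall i, loc_Lq 1 (F i)) ->
  fmeas (fun x => \sum_(i <- r) F i x) = \sum_(i <- r) fmeas (F i).
Proof.
move=> F1; elim: r => [|i r ih].
  rewrite big_nil (_ : (fun x => _) = fun x => cst 0 x - cst 0 x); last first.
    by apply/funext => x; rewrite big_nil subrr.
  by rewrite (fmeasB (loc_Lq0 (lexx 1)) (loc_Lq0 (lexx 1))) subrr.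
rewrite big_cons -ih -(fmeasD (F1 i) (loc_Lq_sum r (lexx 1) F1)).
by congr fmeas; apply/funext => x; rewrite big_cons.
Qed.

Lemma has_lbound_supp mu : lfm_diff mu -> has_lbound (supp mu).
Proof.
move=> [m [n mumn]]; have [[a ma] _] := lfmP m; have [[b nb] _] := lfmP n.
exists (Num.min a b) => x sx; rewrite leNgt; apply/negP => xab.
have oU : open (`]-oo, Num.min a b[%classic : set R) by exact: interval_open.
have [|A [bA Aab]] := sx _ oU; first by rewrite /= in_itv.
apply; rewrite mumn// (lfm_le0 ma) ?(lfm_le0 nb) ?subrr//; try exact: bA.1.
- by move=> t /Aab; rewrite /= !in_itv/= lt_min => /andP[].
- by move=> t /Aab; rewrite /= !in_itv/= lt_min => /andP[].
Qed.

(** Also true for an empty support, where [inf_supp] is 0 by convention: the set function then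
    vanishes on every bounded Borel set. *)
Lemma vanishes_on_inf_supp mu : lfm_diff mu ->
  vanishes_on mu `]-oo, inf_supp mu[.
Proof.
move=> dmu; apply: vanishes_on_supp => //; apply/seteqP; split => // x /= [].
rewrite in_itv/= => xinf sx; have := ge_inf (has_lbound_supp dmu) sx.
by rewrite leNgt xinf.
Qed.

Lemma inf_supp_le0 mu : lfm_diff mu -> vanishes_on mu `]0, +oo[ -> inf_supp mu <= 0.
Proof.
move=> dmu mu0; rewrite /inf_supp.
have [->|/set0P[x sx]] := eqVneq (supp mu) set0; first by rewrite inf0.
apply: (le_trans (ge_inf (has_lbound_supp dmu) sx)); rewrite leNgt; apply/negP => x0.
have oU : open (`]0, +oo[%classic : set R) by exact: interval_open.
have [|A [bA A0]] := sx _ oU; first by rewrite /= in_itv/= x0.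
by apply; exact: mu0.
Qed.

Lemma fmeas_patch_vanishes f B C : measurable B -> loc_Lq 1 f -> B `&` C = set0 ->
  vanishes_on (fmeas (f \_ B)) C.
Proof.
move=> mB f1 BC A bA AC; rewrite fmeas_patch//.
rewrite (_ : A `&` B = set0) ?lmeas_set0//.
by apply/seteqP; split => // x [/AC Cx Bx]; rewrite -BC.
Qed.

Lemma fmeas_vanishes f C : loc_Lq 1 f -> (forall x, C x -> f x = 0) ->
  vanishes_on (fmeas f) C.
Proof.
move=> f1 f0 A bA AC; rewrite (fmeasE f1 bA) /fint integral0_eq// => x /AC Cx.
by rewrite f0.
Qed.

Lemma M_minus_lfm_diff mu : M_minus mu -> lfm_diff mu.
Proof.
move=> [rmu cmu _]; apply: M_plus_lfm_diff; split => //.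
have [M [_ /(_ (M + 1))]] := compact_bounded cmu; rewrite ltrDl ltr01 => /(_ isT) sM.
exists (- (M + 1)) => x /sM /=; rewrite in_itv/= andbT ler_norml => /andP[].
by [].
Qed.

Lemma M_minus_anticausal mu : M_minus mu -> anticausal (to_lmeas mu).
Proof.
move=> Mmu A bA A0; have dmu := M_minus_lfm_diff Mmu; rewrite to_lmeasE//.
apply: (vanishes_on_supp dmu _ bA A0); apply/seteqP; split => // x /= [].
have [_ _ s0] := Mmu; rewrite in_itv/= andbT => x0 /s0/=.
by rewrite in_itv/= leNgt x0.
Qed.

(** The test sets avoid the origin because anticausal elements may have an atom there; [restr_pos]
    keeps the origin, but it is Lebesgue negligible. *)
Lemma ae_equal_restr_pos f g : loc_Lq 1 f -> loc_Lq 1 g ->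
  (forall A, bounded_borel A -> A `<=` `]0, +oo[ -> fmeas f A = fmeas g A) ->
  ae_equal (restr_pos f) (restr_pos g).
Proof.
move=> f1 g1 fg.
have ae1 : ae_eq L `]0, +oo[%classic f g by exact: fint_ae_eq.
have ae2 : \forall x \ae L, x <> 0.
  exists [set 0]; split => //=; first exact: lebesgue_measure_set1.
  by move=> x /= /contrapT.
apply: filterS2 ae1 ae2 => x fgx x0 _; rewrite /restr_pos !patchE.
case: ifPn => //; rewrite inE/= in_itv/= andbT => x0'.
by apply: fgx; rewrite /= in_itv/= andbT lt_neqAle x0' andbT eq_sym; apply/eqP.
Qed.

End Elements.

(** * Truncation of inputs *)

Section LqSpaces.
Context {R : realType}.
Local Notation T := (measurableTypeR R).
Local Notation L := (@lebesgue_measure R).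
Implicit Types (q : R) (f g : R -> R).

Lemma Lfun_powRP q (f : T -> R) : 1 <= q -> reflect
  (measurable_fun setT f /\ (\int[L]_x (`|f x| `^ q)%:E < +oo)%E)
  (f \in Lfun L q%:E).
Proof.
move=> q1; have q0 : q != 0 by rewrite gt_eqF// (lt_le_trans ltr01).
apply: (iffP idP) => [|[mf fq]].
  rewrite inE => /andP[/[1!inE]/= mf fin]; split => //.
  have : ('N[L]_q%:E[EFin \o f] `^ q < +oo)%E.
    by apply: poweR_lty; move: fin; rewrite inE.
  by rewrite powR_Lnorm.
rewrite inE; apply/andP; split; rewrite inE//=.
by rewrite /finite_norm unlock; exact: poweR_lty.
Qed.

Lemma Omega_loc_Lq q f : 1 <= q -> Omega q f -> loc_Lq q f.
Proof.
move=> q1 [/(Lfun_powRP _ q1)[mf fq] [i _ fi]]; split.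
- exact: mf.
- exists (- i%:R) => x xi; apply: fi; rewrite /= in_itv/= => /andP[].
  by rewrite leNgt xi.
- move=> b; apply: le_lt_trans fq; apply: ge0_subset_integral => //.
  exact: measurable_powR_norm.
Qed.

Lemma loc_Lq_Omega q f a : 1 <= q -> loc_Lq q f ->
  vanishes_outside `[a, 0] f -> Omega q f.
Proof.
move=> q1 [mf _ fq] fa; have q0 : q != 0 by rewrite gt_eqF// (lt_le_trans ltr01).
split.
  apply/(Lfun_powRP _ q1); split; first exact: mf.
  apply: le_lt_trans (fq 0); rewrite [leRHS]integral_mkcond.
  rewrite le_eqVlt; apply/orP; left; apply/eqP; apply: eq_integral => x _.
  rewrite patchE; case: ifPn => //; rewrite notin_setE/= in_itv/= => x0.
  rewrite fa ?normr0 ?powR0// => /=; rewrite in_itv/= => /andP[_ x0'].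
  exact: x0.
exists (Num.truncn `|a|).+1 => // x xa; apply: fa => /=; move: xa.
rewrite /= !in_itv/= => xa /andP[ax x0]; apply: xa; rewrite x0 andbT.
apply: le_trans ax; rewrite lerNl; apply: le_trans (ltW (truncnS_gt `|a|)).
by rewrite -normrN ler_norm.
Qed.

Lemma Lnorm_ae_eq q (f g : T -> R) : measurable_fun setT f -> measurable_fun setT g ->
  ae_eq L setT f g -> ('N[L]_q%:E[EFin \o f] = 'N[L]_q%:E[EFin \o g])%E.
Proof.
move=> mf mg fg. rewrite unlock.
apply: (congr1 (fun a => (a `^ q^-1)%E)); apply: ae_eq_integral.
- exact: measurableT.
- exact: measurable_powR_norm.
- exact: measurable_powR_norm.
- by apply: filterS fg => x fgx _; rewrite /= fgx.
Qed.

Lemma cvg_Lloc_ae_eq q (f f' : nat -> R -> R) y : 1 <= q -> Gamma q y ->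
  (forall n, measurable_fun setT (f n)) -> (forall n, measurable_fun setT (f' n)) ->
  (forall n, ae_equal (f n) (f' n)) -> cvg_Lloc q f y -> cvg_Lloc q f' y.
Proof.
move=> q1 [y0 yq] mf mf' ff' fy b; have := fy b.
have [my _] := Lfun_powRP _ q1 (yq b).
(* [Gamma] gives measurability of [y] only after restriction to [[0, b]], so the restriction is
   distributed over the difference. *)
have mB g : measurable_fun setT g -> measurable_fun setT ((g \- y) \_ `[0, b]).
  move=> mg; rewrite (_ : _ \_ _ = (g \_ `[0, b]) \- (y \_ `[0, b])); last first.
    by apply/funext => x /=; rewrite !patchE; case: ifP => _ //; rewrite subrr.
  apply: measurable_funB => //.
  by apply/(measurable_restrictT _ _).1 => //; exact: measurable_funTS.
rewrite (_ : (fun n => _) = (fun n =>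
  'N[L]_q%:E[EFin \o ((f' n \- y)%R \_ `[0%R, b])])%E)//.
apply/funext => n; apply: Lnorm_ae_eq; [exact: mB|exact: mB|].
by apply: filterS (ff' n) => x fgx _; rewrite !patchE /= fgx.
Qed.

End LqSpaces.

Section Truncation.
Context {R : realType} (q : R) (d m : nat).
Variables (Q Qinv : 'M[set R -> R]_d) (P : 'M[set R -> R]_(d, m)).
Hypotheses (q1 : 1 <= q)
  (hQ : forall i j, M_minus (Q i j)) (hP : forall i j, M_minus (P i j))
  (hQinv : conv_inverse Q Qinv).

Let dQ i j : lfm_diff (Q i j). Proof. exact: M_minus_lfm_diff. Qed.
Let dP i j : lfm_diff (P i j). Proof. exact: M_minus_lfm_diff. Qed.
Let dQinv i j : lfm_diff (Qinv i j).
Proof. by apply: M_plus_lfm_diff; case: hQinv. Qed.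

Let Q' := map_mx to_lmeas Q.
Let P' := map_mx to_lmeas P.
Let Qinv' := map_mx to_lmeas Qinv.
Let H := mxconv Qinv P.
Let delta := \det Q'.
Let l := inf_supp (convdet Q).

Let dH i j : lfm_diff (H i j). Proof. exact: mxconv_diff. Qed.

Let Qinv'K : Qinv' *m Q' = 1%:M.
Proof.
rewrite -to_lmeas_mxdelta -to_lmeas_mxconv//; have [_ QQ _] := hQinv.
apply/matrixP => i j; rewrite !mxE; apply: lmeasP => A bA.
have := QQ i j A bA; rewrite !mxE => QQA.
rewrite !to_lmeasE//; last first.
  by have := mxconv_diff dQinv dQ i j; rewrite mxE.
case: eqP => _; [exact: lfm_diff_delta0|exact: lfm_diff0].
Qed.

Let ddet : lfm_diff (convdet Q). Proof. exact: convdet_diff. Qed.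

Let deltaE : to_lmeas (convdet Q) = delta. Proof. exact: to_lmeas_convdet. Qed.

Let Q'0 i j : anticausal (Q' i j).
Proof. by rewrite mxE; exact: M_minus_anticausal. Qed.

Let P'0 i j : anticausal (P' i j).
Proof. by rewrite mxE; exact: M_minus_anticausal. Qed.

Let delta_anticausal : anticausal delta. Proof. exact: anticausal_det. Qed.

Let delta_inf : vanishes_on delta `]-oo, l[.
Proof.
by move=> A bA Al; rewrite -deltaE to_lmeasE// (vanishes_on_inf_supp ddet).
Qed.

Lemma inf_supp_convdet_le0 : l <= 0.
Proof.
apply: inf_supp_le0 => // A bA A0; have := delta_anticausal bA A0.
by rewrite -deltaE to_lmeasE.
Qed.

Lemma loc_Lq_mxconvf (u : 'I_m -> R -> R) i : (forall k, loc_Lq q (u k)) ->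
  loc_Lq q (mxconvf H u i).
Proof.
move=> uq; apply: (loc_Lq_sum _ q1) => k; exact: (loc_Lq_convf q1 (dH i k) (uq k)).
Qed.

Let fmeas_mxconvf (u : 'I_m -> R -> R) i : (forall k, loc_Lq 1 (u k)) ->
  fmeas (mxconvf H u i) = (Qinv' *m P' *m \col_k fmeas (u k)) i 0.
Proof.
move=> u1; rewrite (fmeas_sum _ (fun k => loc_Lq_convf (lexx 1) (dH i k) (u1 k))).
rewrite -to_lmeas_mxconv// mxE; apply: eq_bigr => k _.
by rewrite (fmeas_convf (dH i k) (u1 k)) !mxE.
Qed.

(** [Qinv'] itself need not be anticausal, but [delta] times it is the adjugate of [Q'], whose
    entries are polynomials in those of [Q']. The identity comes from multiplying Cramer's rule by
    [Qinv'] on the left. *)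
Let adj_output (Psi : 'cV[@lmeas R]_m) i : (forall k, anticausal (Psi k 0)) ->
  anticausal ((Qinv' *m P' *m (delta%:M *m Psi)) i 0).
Proof.
move=> Psi0; rewrite mul_scalar_mx -scalemxAr -mulmxA scalemxAl.
rewrite (_ : delta *: Qinv' = \adj Q').
  apply: anticausal_mulmx; first exact: anticausal_adj.
  by apply: anticausal_mulmx => // k j; rewrite ord1.
by rewrite -mul_mx_scalar -mul_mx_adj mulmxA Qinv'K mul1mx.
Qed.

Lemma input_truncation (u : 'I_m -> R -> R) : input q u ->
  exists v, input_in q (- l) v /\
    forall i, ae_equal (output Qinv P u i) (output Qinv P v i).
Proof.
move=> uq; have u_q k : loc_Lq q (u k) by exact: (Omega_loc_Lq q1 (uq k)).
have toL1 f : loc_Lq q f -> loc_Lq 1 f by exact: loc_Lq1.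
have u_1 k := toL1 _ (u_q k).
(* [\det Qinv'] is the inverse of [delta]; being a ring element, it coerces to a set function to
   which [convf] applies. *)
pose w k := convf (\det Qinv') (u k).
have dw : lfm_diff (\det Qinv') by exact: lmeas_diff.
have wq k : loc_Lq q (w k) := loc_Lq_convf q1 dw (u_q k).
have w1 k := toL1 _ (wq k).
pose psi k := w k \_ `]-oo, 0]; pose chi k := w k \_ `]0, +oo[.
have psiq k : loc_Lq q (psi k) := loc_Lq_patch q1 (measurable_itv _) (wq k).
have psi1 k := toL1 _ (psiq k).
pose v0 k x := u k x - convf (convdet Q) (psi k) x.
have Dpsiq k : loc_Lq q (convf (convdet Q) (psi k)) := loc_Lq_convf q1 ddet (psiq k).
have v0q k : loc_Lq q (v0 k) := loc_LqB q1 (u_q k) (Dpsiq k).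
have v01 k := toL1 _ (v0q k).
(* [v0] vanishes outside of [[l, 0]] only as a measure, whereas inputs must vanish there at every
   point; the cut changes it on a negligible set. *)
pose v k := v0 k \_ `[l, 0].
have vq k : loc_Lq q (v k) := loc_Lq_patch q1 (measurable_itv _) (v0q k).
have v1 k := toL1 _ (vq k).
have psi0 k : anticausal (fmeas (psi k)).
  apply: (fmeas_patch_vanishes (measurable_itv _) (w1 k)).
  by apply/seteqP; split => // x [] /=; rewrite !in_itv/= andbT leNgt => /negP.
have chi0 k : vanishes_on (fmeas (chi k)) `]-oo, 0].
  apply: (fmeas_patch_vanishes (measurable_itv _) (w1 k)).
  by apply/seteqP; split => // x [] /=; rewrite !in_itv/= andbT ltNge => /negP.
have wE k : fmeas (w k) = fmeas (psi k) + fmeas (chi k).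
  apply: lmeasP => A bA; rewrite lmeasD.
  have psiA : fmeas (psi k) A = fmeas (w k) (A `&` `]-oo, 0]).
    exact: (fmeas_patch (measurable_itv _) (w1 k) bA).
  have chiA : fmeas (chi k) A = fmeas (w k) (A `&` `]0, +oo[).
    exact: (fmeas_patch (measurable_itv _) (w1 k) bA).
  rewrite psiA chiA.
  have mN : measurable (`]-oo, 0]%classic : set R) by exact: measurable_itv.
  rewrite [LHS](lmeas_setID (fmeas (w k)) bA mN).
  by rewrite setDE setCitvl.
have v0E k : fmeas (v0 k) = fmeas (u k) - delta * fmeas (psi k).
  rewrite (fmeasB (u_1 k) (toL1 _ (Dpsiq k))).
  by rewrite (fmeas_convf ddet (psi1 k)) deltaE.
(* The second expression of [v0]: [v0E] controls its support on the right, this one on the left. *)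
have v0chi k : fmeas (v0 k) = delta * fmeas (chi k).
  have : delta * fmeas (w k) = fmeas (u k).
    rewrite (fmeas_convf dw (u_1 k)) to_lmeas_id mulrA -det_mulmx.
    by rewrite (mulmx1C Qinv'K) det1 mul1r.
  by rewrite wE mulrDr v0E => <-; rewrite addrC addKr.
have v0_inf k : vanishes_on (fmeas (v0 k)) `]-oo, l[.
  rewrite v0chi; apply: (vanishes_onM _ _ delta_inf (chi0 k)) => // s t.
  rewrite /= !in_itv/= => st; have [sl|sl] := ltP s l; [by left|right]; lra.
have v0_pos k : anticausal (fmeas (v0 k)).
  rewrite v0E; apply: vanishes_onD; last first.
    by apply: vanishes_onN; exact: anticausalM.
  apply: (fmeas_vanishes (u_1 k)) => x /=; rewrite in_itv/= andbT => x0.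
  have [_ [i _ ui]] := uq k; apply: ui => /=; rewrite in_itv/= => /andP[_].
  by rewrite leNgt x0.
(* A bounded set splits into its parts in [[l, 0]], before [l] and after 0; [v0_inf] and [v0_pos]
   remove the last two. *)
have vE k : fmeas (v k) = fmeas (v0 k).
  apply: lmeasP => A bA; rewrite (fmeas_patch (measurable_itv _) (v01 k) bA).
  have mN : measurable (`[l, 0]%classic : set R) by exact: measurable_itv.
  rewrite [RHS](lmeas_setID (fmeas (v0 k)) bA mN).
  have bB : bounded_borel (A `\` `[l, 0]%classic).
    by apply: (bounded_borelS _ _ bA); [exact: measurableD bA.1 mN|exact: subDsetl].
  have ml : measurable (`]-oo, l[%classic : set R) by exact: measurable_itv.
  rewrite (lmeas_setID (fmeas (v0 k)) bB ml).
  rewrite [X in _ = _ + (X + _)](v0_inf k); last 2 first.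
  - by apply: (bounded_borelS _ _ bB); [exact: measurableI bB.1 ml|exact: subIsetl].
  - exact: subIsetr.
  rewrite [X in _ = _ + (_ + X)](v0_pos k) ?addr0//.
  - by apply: (bounded_borelS _ _ bB); [exact: measurableD bB.1 ml|exact: subDsetl].
  - move=> x [[_]] /=; rewrite !in_itv/= andbT => /negP; rewrite negb_and -!ltNge.
    by case/orP => [->|].
have vout k : vanishes_outside `[l, 0] (v k).
  by move=> x xl; rewrite /v patchE memNset.
exists v; split.
  split => k; first exact: (loc_Lq_Omega q1 (vq k) (vout k)).
  by rewrite opprK; exact: vout.
move=> i; apply: ae_equal_restr_pos.
- exact: (toL1 _ (loc_Lq_mxconvf i u_q)).
- exact: (toL1 _ (loc_Lq_mxconvf i vq)).
move=> A bA A0; rewrite (fmeas_mxconvf i u_1) (fmeas_mxconvf i v1).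
rewrite (_ : \col_k fmeas (v k) = \col_k fmeas (u k) -
    delta%:M *m \col_k fmeas (psi k)); last first.
  by apply/colP => k; rewrite mul_scalar_mx !mxE vE v0E.
have subE (x y : @lmeas R) : (x - y) A = x A - y A by rewrite lmeasD lmeasN.
have mxB (X Y : 'cV[@lmeas R]_d) : (X - Y) i 0 = X i 0 - Y i 0 by rewrite !mxE.
rewrite mulmxBr [in RHS]mxB [RHS]subE.
rewrite [X in _ = _ - X](@adj_output (\col_k fmeas (psi k)) i _ A bA A0) ?subr0//.
by move=> k; rewrite mxE.
Qed.

End Truncation.

(** * Reachability in bounded time *)

Section Output.
Context {R : realType} (q : R) (d m : nat).
Variables (Q Qinv : 'M[set R -> R]_d) (P : 'M[set R -> R]_(d, m)).
Hypotheses (q1 : 1 <= q)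
  (hQ : forall i j, M_minus (Q i j)) (hP : forall i j, M_minus (P i j))
  (hQinv : conv_inverse Q Qinv).

Let l := inf_supp (convdet Q).

Lemma measurable_output (u : 'I_m -> R -> R) i : input q u ->
  measurable_fun setT (output Qinv P u i).
Proof.
move=> uq; have [mY _ _] := @loc_Lq_mxconvf R q d m Q Qinv P q1 hP hQinv u i
  (fun k => Omega_loc_Lq q1 (uq k)).
by apply/(measurable_restrictT _ _).1 => //; exact: measurable_funTS.
Qed.

Lemma input_inW (T T' : R) (u : 'I_m -> R -> R) : T <= T' ->
  input_in q T u -> input_in q T' u.
Proof.
move=> TT' [uq u0]; split => // k x xT; apply: u0 => xT0; apply: xT; move: xT0.
by rewrite /= !in_itv/= => /andP[Tx ->]; rewrite andbT (le_trans _ Tx)// lerN2.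
Qed.

(** Each term of the approximating sequence is truncated separately. Its output is unchanged almost
    everywhere, so the seminorms of the errors, and thus the limit, are the same. *)
Lemma quasi_reachable_truncation T : - l < T ->
  quasi_reachable q Q Qinv P -> quasi_reachable_in q Q Qinv P T.
Proof.
move=> lT qr y Xy; have [u [uq uy]] := qr y Xy.
have /choice[v vP] n := input_truncation q1 hQ hP hQinv (uq n).
exists v; split => [n|i]; first exact: (input_inW (ltW lT) (vP n).1).
apply: (cvg_Lloc_ae_eq q1 (Xy.1 i) _ _ _ (uy i)) => n.
- exact: measurable_output (uq n).
- exact: measurable_output (vP n).1.1.
- exact: (vP n).2.
Qed.

Lemma reachable_truncation T : - l < T ->
  reachable q Q Qinv P -> reachable_in q Q Qinv P T.
Proof.
move=> lT r y Xy; have [u [uq uy]] := r y Xy.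
have [v [vq uv]] := input_truncation q1 hQ hP hQinv uq.
exists v; split => [|i]; first exact: input_inW (ltW lT) vq.
by apply: filterS2 (uv i) (uy i) => x uvx uyx _; rewrite -uvx// uyx.
Qed.

End Output.

(** The time [a + e] is admissible for every [e > 0]; its positivity comes from [0 <= a]. *)
Lemma ereal_inf_gt (R : realType) (A : set R) (a : R) : 0 <= a ->
  (forall T, a < T -> A T) ->
  (ereal_inf [set T%:E | T in [set T : R | 0 < T /\ A T]%R] <= a%:E)%E.
Proof.
move=> a0 aA; apply/lee_addgt0Pr => e e0; apply: ereal_inf_lbound.
exists (a + e) => //=; split; first by rewrite ltr_wpDl.
by apply: aA; rewrite ltrDl.
Qed.

Theorem theorem4p1 (R : realType) (q : R) (d m : nat)
    (Q Qinv : 'M[set R -> R]_d) (P : 'M[set R -> R]_(d, m))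
    (hq : 1 <= q) (hd : (0 < d)%N) (hm : (0 < m)%N)
    (hQ : forall i j, M_minus (Q i j))
    (hP : forall i j, M_minus (P i j))
    (hQinv : conv_inverse Q Qinv) :
  [/\ quasi_reachable q Q Qinv P <->
        (forall T : R, - inf_supp (convdet Q) < T -> quasi_reachable_in q Q Qinv P T),
      reachable q Q Qinv P <->
        (forall T : R, - inf_supp (convdet Q) < T -> reachable_in q Q Qinv P T),
      quasi_reachable q Q Qinv P ->
        (Tmin_qr q Q Qinv P <= (- inf_supp (convdet Q))%:E)%E &
      reachable q Q Qinv P ->
        (Tmin_r q Q Qinv P <= (- inf_supp (convdet Q))%:E)%E].
Proof.
have l0 : 0 <= - inf_supp (convdet Q) by rewrite oppr_ge0; exact: inf_supp_convdet_le0.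
(* For the converse directions, a single time beyond the bound is enough. *)
have lT : - inf_supp (convdet Q) < - inf_supp (convdet Q) + 1 by rewrite ltrDl.
split.
- split=> [qr T T0|/(_ _ lT) qr y /qr[u [uq uy]]].
    exact: quasi_reachable_truncation qr.
  by exists u; split => // n; exact: (uq n).1.
- split=> [r T T0|/(_ _ lT) r y /r[u [uq uy]]].
    exact: reachable_truncation r.
  by exists u; split => //; exact: uq.1.
- by move=> qr; apply: ereal_inf_gt => // T T0; exact: quasi_reachable_truncation qr.
- by move=> r; apply: ereal_inf_gt => // T T0; exact: reachable_truncation r.
Qed.
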